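(* Let $4\le k\le d$. If $P$ is a $d$-dimensional polytope with $v=d+k$ vertices which is not a triplex, then $P$ has at least $\phi(v,d)+k-3$ edges. Equivalently, its excess degree $2f_1(P)-d f_0(P)$ is at least $(k-1)(d-k)+2(k-3)$.
   Context: $\phi(v,d)=\binom{d+1}{2}+\binom{d}{2}-\binom{2d+1-v}{2}$. For $1\le k\le d$, the triplex $M_{k,d-k}$ is any polytope combinatorially equivalent to a $(d-k)$-fold pyramid over a $k$-dimensional simplicial prism (combinatorially the product of a $(k-1)$-simplex and a segment); a $d$-polytope with $d+k$ vertices is a triplex iff it is $M_{k,d-k}$. *)

(* Defs.v *)
From HB Require Import structures.
From mathcomp Require Import all_boot all_order all_algebra finmap.
From mathcomp Require Import boolp classical_sets functions cardinality.
From mathcomp Require Import reals convex.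

Set Implicit Arguments.
Unset Strict Implicit.
Unset Printing Implicit Defensive.

Import Order.TTheory GRing.Theory Num.Theory.

Local Open Scope classical_set_scope.
Local Open Scope ring_scope.

Section Hulls.
Variables (R : realType) (n : nat).
Implicit Types X : set 'rV[R]_n.

Definition conv_hull X : set 'rV[R]_n := smallest (@convex_set R 'rV[R]_n) X.

Definition affine_set X : Prop :=
  forall (x y : 'rV[R]_n) (t : R), X x -> X y -> X ((1 - t) *: x + t *: y).

Definition aff_hull X : set 'rV[R]_n := smallest affine_set X.

Definition aff_indep m (x : 'I_m -> 'rV[R]_n) : Prop :=
  forall w : 'I_m -> R, \sum_i w i = 0 -> \sum_i w i *: x i = 0 ->
  forall i, w i = 0.

(* The affine hull of X is a translate of a linear subspace of dimension d;
   this holds for no d when X is empty. *)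
Definition has_dim X (d : nat) : Prop :=
  exists (x0 : 'rV[R]_n) (U : {vspace 'rV[R]_n}),
    \dim U = d /\ aff_hull X = [set x0 + u | u in [set u | u \in U]].

Definition is_polytope X : Prop :=
  exists s : seq 'rV[R]_n, X = conv_hull [set` s].

(* F is cut out of P by an inequality valid on P. The inequalities 0 <= 1 and
   0 <= 0 yield the empty face and P itself. *)
Definition face (P F : set 'rV[R]_n) : Prop :=
  exists (a : 'cV[R]_n) (b : R),
    (forall x, P x -> (x *m a) 0 0 <= b) /\
    F = [set x | P x /\ (x *m a) 0 0 = b].

(* fset_set is set0 on infinite sets, but a polytope has finitely many faces. *)
Definition f_number (i : nat) (P : set 'rV[R]_n) : nat :=
  #|` fset_set [set F | face P F /\ has_dim F i]|.

Definition excess_degree (d : nat) (P : set 'rV[R]_n) : int :=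
  (2 * f_number 1 P)%N%:Z - (d * f_number 0 P)%N%:Z.

Definition is_simplex (r : nat) X : Prop :=
  exists x : 'I_r.+1 -> 'rV[R]_n, aff_indep x /\ X = conv_hull (range x).

Definition pyramid (Q P : set 'rV[R]_n) : Prop :=
  exists a : 'rV[R]_n, ~ aff_hull Q a /\ P = conv_hull (Q `|` [set a]).

Fixpoint multi_pyramid (r : nat) (B P : set 'rV[R]_n) : Prop :=
  if r is r'.+1 then exists Q, multi_pyramid r' B Q /\ pyramid Q P
  else P = B.

End Hulls.

(* An isomorphism of face lattices, the empty face and the polytope included. *)
Definition comb_equiv (R : realType) m n
    (P : set 'rV[R]_m) (Q : set 'rV[R]_n) : Prop :=
  exists f : set 'rV[R]_m -> set 'rV[R]_n,
    set_bij (face P) (face Q) f /\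
    forall F G, face P F -> face P G -> (F `<=` G <-> f F `<=` f G).

Definition prod_polytope (R : realType) m n
    (P : set 'rV[R]_m) (Q : set 'rV[R]_n) : set 'rV[R]_(m + n) :=
  [set row_mx x y | x in P & y in Q].

(* Meaningful for 1 <= k. *)
Definition simplicial_prism (R : realType) n (k : nat)
    (B : set 'rV[R]_n) : Prop :=
  is_polytope B /\
  exists (a b : nat) (T : set 'rV[R]_a) (I : set 'rV[R]_b),
    is_simplex k.-1 T /\ is_simplex 1 I /\ comb_equiv B (prod_polytope T I).

(* P is an M_{k,d-k}; the model pyramid may live in another ambient space. *)
Definition triplex (R : realType) n (d k : nat) (P : set 'rV[R]_n) : Prop :=
  (1 <= k <= d)%N /\ is_polytope P /\
  exists (m : nat) (B Q : set 'rV[R]_m),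
    simplicial_prism k B /\ multi_pyramid (d - k) B Q /\ comb_equiv P Q.

(* The subtraction is truncated; no truncation occurs for v <= 2d + 1. *)
Definition phi (v d : nat) : nat :=
  ('C(d.+1, 2) + 'C(d, 2) - 'C(2 * d + 1 - v, 2))%N.

(* Main.v *)
(* A homogenized vertex set is a finite family of vectors, and a face is the zero
   set of a linear form that is nonnegative on the family.  Every vertex has
   degree at least d, so n vertices meet at least n d - C(n, 2) edges; removing a
   facet that misses n >= 2 vertices gives the bound phi by induction on d, with a
   surplus of (n - 2)(k - n).  The surplus is at least k - 3 unless n is 2 or k,
   and two facets missing {x, y} and {x, z} also give it, since then y is joined
   to all the vertices other than x, y, z.  So all facets miss 1, 2 or k vertices,
   with disjoint pairs, and some facet S misses k, hence is a simplex.  Each s in S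
   is avoided by a facet through S - s.  If this facet is a simplex, its vertex
   outside S is joined to all of S - s, which again gives the surplus.  Otherwise
   it misses s alone, and P is a pyramid with apex s, or it misses a pair {s, t}.
   Signs of affine coordinates with respect to S and one more vertex show that the
   pairs exhaust the complement of S and span a simplicial prism, so that P is a
   triplex. *)

(* The constant comes from [(n - 2)(k - n) - (k - 3) = (n - 3)(k - n - 1)]: for [3 <= n <= k - 1]
   the least surplus is [k - 3], attained at both ends. The two arguments with joined vertices even
   give [k - 2]. Since [phi (d + k) d = d * d - 'C(d.+1 - k, 2)], the estimates carry the binomial
   on the side of the edges, which avoids truncated subtraction. The obstacle lies at the end: being
   a triplex is a statement about the whole face lattice, while counting provides only some facets,
   and a polytope combinatorially equivalent to a prism need not be an affine product. What the
   facets do give is relations [v (tau s') + a *: v s = b *: v (tau s) + c *: v s'] with positive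
   coefficients: the diagonals of a quadrilateral cross. Together with the bases and the sides,
   these relations determine all faces of the base, and the model prism satisfies them with
   coefficients 1. *)
From HB Require Import structures.
Require Import Defs.
From mathcomp Require Import all_boot all_order all_algebra.
From mathcomp Require Import boolp.
From mathcomp Require Import zify ring lra.

Set Implicit Arguments.
Unset Strict Implicit.
Unset Printing Implicit Defensive.

Import Order.TTheory GRing.Theory Num.Theory.
Local Open Scope ring_scope.

(** * Linear forms and separation from a subspace *)

Section LinearForm.
Variables (R : realFieldType) (E : vectType R).
Implicit Types (l : 'Hom(E, R^o)) (x : E).

(** The value is typed in [R] rather than [R^o], so that [lra], [ring] and the order lemmas apply to
    it. *)
Definition ev l x : R := l x.

Lemma evD l x y : ev l (x + y) = ev l x + ev l y.
Proof. by rewrite /ev linearD. Qed.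
Lemma evZ l a x : ev l (a *: x) = a * ev l x.
Proof. by rewrite /ev linearZ. Qed.
Lemma evN l x : ev l (- x) = - ev l x.
Proof. by rewrite /ev linearN. Qed.
Lemma ev0 l : ev l 0 = 0.
Proof. by rewrite /ev linear0. Qed.
Lemma ev_sum l (I : Type) (r : seq I) (P : pred I) (F : I -> E) :
  ev l (\sum_(i <- r | P i) F i) = \sum_(i <- r | P i) ev l (F i).
Proof. by rewrite /ev linear_sum. Qed.
Lemma ev_addf l l' x : ev (l + l') x = ev l x + ev l' x.
Proof. by rewrite /ev lfunE. Qed.
Lemma ev_scalef a l x : ev (a *: l) x = a * ev l x.
Proof. by rewrite /ev lfunE. Qed.
Lemma ev_oppf l x : ev (- l) x = - ev l x.
Proof. by rewrite /ev lfunE. Qed.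
Lemma ev_zerof x : ev 0 x = 0.
Proof. by rewrite /ev lfunE. Qed.

Definition evE := (evD, evZ, evN, ev0, ev_addf, ev_scalef, ev_oppf, ev_zerof).

(** The map [\1 - projv U] kills [U] but not [x], so one of its coordinates is the required form. *)
Lemma separating_form (U : {vspace E}) x :
  x \notin U -> exists l, (forall u, u \in U -> ev l u = 0) /\ ev l x != 0.
Proof.
move=> xU; pose p := projv U.
have y0 : x - p x != 0.
  apply: contra xU; rewrite subr_eq0 => /eqP ->; exact: memv_proj.
pose b := vbasis (fullv : {vspace E}).
have /existsP[i ci] : [exists i, coord b i (x - p x) != 0].
  apply: contraNT y0; rewrite negb_exists => /forallP h.
  rewrite (coord_vbasis (memvf (x - p x))) big1 // => i _.
  by move/eqP: (negbNE (h i)) => ->; rewrite scale0r.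
exists (linfun (coord b i : E -> R^o) \o (\1 - p))%VF.
by split=> [u uU|]; rewrite /ev comp_lfunE !lfunE /= !lfunE //= projv_id ?subrr ?linear0.
Qed.

End LinearForm.

(** * Rank, faces and facets of a finite family of vectors *)

Section Configuration.
Variables (R : realFieldType) (E : vectType R) (I : finType) (v : I -> E).
Implicit Types (X Y Z F G : {set I}) (l : 'Hom(E, R^o)) (i j : I).

Definition span_of X : {vspace E} := (\sum_(i in X) <[v i]>)%VS.
Definition rk X := \dim (span_of X).

Lemma mem_span X i : i \in X -> v i \in span_of X.
Proof. by move=> iX; apply: (subvP (sumv_sup i iX (subvv _))); exact: memv_line. Qed.

Lemma span_sub X (U : {vspace E}) :
  (forall i, i \in X -> v i \in U) -> (span_of X <= U)%VS.
Proof. by move=> h; apply/subv_sumP => i iX; rewrite -memvE h. Qed.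

Lemma span_mono X Y : X \subset Y -> (span_of X <= span_of Y)%VS.
Proof. by move=> /subsetP sXY; apply: span_sub => i /sXY; exact: mem_span. Qed.

Lemma rk_mono X Y : X \subset Y -> (rk X <= rk Y)%N.
Proof. by move=> /span_mono; exact: dimvS. Qed.

Lemma rkU1 i X : (rk (i |: X) <= (rk X).+1)%N.
Proof.
have /dimvS : (span_of (i |: X) <= <[v i]> + span_of X)%VS.
  apply: span_sub => j; rewrite inE => /orP[/set1P ->|jX].
    by apply: (subvP (addvSl _ _)); exact: memv_line.
  by apply: (subvP (addvSr _ _)); exact: mem_span.
move=> /leq_trans; apply; apply: leq_trans (dimv_add_leqif _ _) _.
by rewrite dim_vline /rk -add1n leq_add2r; case: eqP.
Qed.

Lemma rk0 : rk set0 = 0%N.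
Proof. by rewrite /rk /span_of big_set0 dimv0. Qed.

Lemma span_comb X (x : E) : x \in span_of X ->
  exists c : I -> R, x = \sum_(i in X) c i *: v i.
Proof.
move=> /memv_sumP[u hu ->].
have /choice[c hc] : forall i, exists a, i \in X -> u i = a *: v i.
  move=> i; case: (boolP (i \in X)) => [/hu /vlineP[a ->]|_]; last by exists 0.
  by exists a.
by exists c; apply: eq_bigr => i iX; exact: hc.
Qed.

Lemma vanish_span l X : (forall i, i \in X -> ev l (v i) = 0) ->
  forall x, x \in span_of X -> ev l x = 0.
Proof.
move=> h x /span_comb[c ->]; rewrite ev_sum big1 // => i iX.
by rewrite evZ h // mulr0.
Qed.

(** With [form_of_rk_lt], this trades strict rank inequalities for linear forms and back. *)
Lemma rk_lt l X Y i : X \subset Y -> (forall j, j \in X -> ev l (v j) = 0) ->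
  i \in Y -> ev l (v i) != 0 -> (rk X < rk Y)%N.
Proof.
move=> sXY h iY li; rewrite ltn_neqAle rk_mono // andbT.
apply: contra li => /eqP rXY.
have /eqP eXY : span_of X == span_of Y by rewrite eqEdim span_mono //= -/(rk Y) -rXY.
by apply/eqP; apply: (vanish_span h); rewrite eXY mem_span.
Qed.

Lemma form_of_rk_lt X Y : (rk X < rk Y)%N ->
  exists l i, [/\ i \in Y, forall j, j \in X -> ev l (v j) = 0 & ev l (v i) != 0].
Proof.
move=> rXY; have /existsP[i /andP[iY iX]] : [exists i, (i \in Y) && (v i \notin span_of X)].
  apply: contraLR rXY; rewrite negb_exists -leqNgt => /forallP h.
  apply/dimvS/span_sub => i iY; have := h i.
  by rewrite iY /= negbK.
have [l [lX li]] := separating_form iX.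
by exists l, i; split=> // j jX; apply: lX; exact: mem_span.
Qed.

Lemma rk_le_card X : (rk X <= #|X|)%N.
Proof.
have [n] := ubnP #|X|; elim: n X => // n IH X ltXn.
have [->|/set0Pn[i iX]] := eqVneq X set0; first by rewrite rk0.
rewrite -{1}(setD1K iX) (leq_trans (rkU1 _ _)) // (cardsD1 i X) iX ltnS.
by apply: IH; rewrite (cardsD1 i X) iX in ltXn.
Qed.

(** A form that isolates [i] makes the rank drop when [i] is removed, so the points can be removed
    one by one. *)
Lemma card_le_rk X :
  (forall i, i \in X -> exists l, (forall j, j \in X :\ i -> ev l (v j) = 0) /\ ev l (v i) != 0) ->
  (#|X| <= rk X)%N.
Proof.
have [n] := ubnP #|X|; elim: n X => // n IH X ltXn h.
have [->|/set0Pn[i iX]] := eqVneq X set0; first by rewrite cards0.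
have [l [lX li]] := h _ iX.
have := rk_lt (subD1set _ _) lX iX li; apply: leq_trans.
rewrite (cardsD1 i X) iX ltnS in ltXn *; apply: IH => // j jX.
have [|l' [l'X l'j]] := h j; first by move: jX; rewrite inE => /andP[].
exists l'; split=> // m mX; apply: l'X; move: mX; rewrite !inE.
by case/and3P=> -> _ ->.
Qed.

Definition cface X F :=
  exists l, (forall i, i \in X -> 0 <= ev l (v i)) /\ F = [set i in X | ev l (v i) == 0].

Lemma cface_sub X F : cface X F -> F \subset X.
Proof. by move=> [l [_ ->]]; apply/subsetP => i; rewrite inE => /andP[]. Qed.

Lemma cfacexx X : cface X X.
Proof.
exists 0; split=> [i _|]; first by rewrite ev_zerof.
by apply/setP => i; rewrite inE ev_zerof eqxx andbT.
Qed.

Lemma cface_form X F : cface X F -> exists l, [/\ forall i, i \in X -> 0 <= ev l (v i),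
  forall i, i \in F -> ev l (v i) = 0 & forall i, i \in X -> i \notin F -> 0 < ev l (v i)].
Proof.
move=> [l [l0 ->]]; exists l; split=> // i; first by rewrite inE => /andP[_ /eqP].
by move=> iX; rewrite inE iX /= => ?; rewrite lt_neqAle eq_sym l0 // andbT.
Qed.

Lemma cface_of_form X F l : F \subset X -> (forall i, i \in F -> ev l (v i) = 0) ->
  (forall i, i \in X -> i \notin F -> 0 < ev l (v i)) -> cface X F.
Proof.
move=> /subsetP sFX lF lX; exists l; split=> [i iX|].
  by case: (boolP (i \in F)) => [/lF ->//|/(lX _ iX)/ltW].
apply/setP => i; rewrite inE; case: (boolP (i \in F)) => iF.
  by rewrite sFX // lF // eqxx.
by case: (boolP (i \in X)) => //= iX; rewrite gt_eqF // lX.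
Qed.

Lemma cfaceI X F G : cface X F -> cface X G -> cface X (F :&: G).
Proof.
move=> [l [l0 ->]] [m [m0 ->]]; exists (l + m); split=> [i iX|].
  by rewrite ev_addf addr_ge0 ?l0 ?m0.
apply/setP => i; rewrite !inE; case: (boolP (i \in X)) => //= iX.
by rewrite ev_addf paddr_eq0 ?l0 ?m0.
Qed.

Lemma cface_restrict X Y F : cface X F -> Y \subset X -> cface Y (F :&: Y).
Proof.
move=> [l [l0 ->]] /subsetP sYX; exists l; split=> [i /sYX|]; first exact: l0.
by apply/setP => i; rewrite !inE andbC; case: (boolP (i \in Y)) => //= /sYX ->.
Qed.

Lemma cface_subset X Y F : cface X F -> F \subset Y -> Y \subset X -> cface Y F.
Proof. by move=> hF /setIidPl sFY sYX; rewrite -sFY; exact: cface_restrict sYX. Qed.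

(** A form cutting [G] out of [F] may be negative outside [F]; a large multiple of the form of [F]
    repairs this without changing it on [F]. *)
Lemma cface_trans X F G : cface X F -> cface F G -> cface X G.
Proof.
move=> hF hG; have [l [l0 lF lX]] := cface_form hF.
have [m [m0 mG mF]] := cface_form hG.
have [sFX sGF] := (subsetP (cface_sub hF), subsetP (cface_sub hG)).
have [c [c0 hc]] : exists c : R, 0 <= c /\
    forall i, i \in X -> i \notin F -> 0 < c * ev l (v i) + ev m (v i).
  pose f i := `|ev m (v i)| / ev l (v i).
  (* The multiplier exceeds the sum of the ratios [f i], hence each of them. *)
  exists (1 + \sum_(i in X :\: F) f i); split.
    rewrite addr_ge0 // sumr_ge0 // => i; rewrite inE => /andP[iF iX].
    by rewrite divr_ge0 // l0.
  move=> i iX iF; have li := lX _ iX iF.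
  have hi : f i <= \sum_(j in X :\: F) f j.
    rewrite (bigD1 i) /=; last by rewrite inE iF.
    rewrite lerDl sumr_ge0 // => j /andP[]; rewrite inE => /andP[jF jX] _.
    by rewrite divr_ge0 // l0.
  move: hi; rewrite -(ler_pM2r li) {1}/f divfK ?gt_eqF // mulrDl mul1r.
  have := ler_norm (- ev m (v i)); rewrite normrN; lra.
apply: (@cface_of_form _ _ (c *: l + m)).
- by apply/subsetP => i /sGF/sFX.
- by move=> i iG; rewrite !evE lF ?sGF // mG // mulr0 addr0.
- move=> i iX iG; rewrite !evE; case: (boolP (i \in F)) => iF; last exact: hc.
  by rewrite lF // mulr0 add0r mF.
Qed.

Definition facet X F := cface X F /\ (rk F).+1 = rk X.

Lemma facet_face X F : facet X F -> cface X F. Proof. by case. Qed.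

(** If the inclusion were strict, the rank would rise once from [F] to [G] and again from [G] to
    [X], but a facet has corank 1. *)
Lemma facet_subset_eq X F G : facet X F -> cface X G -> G != X -> F \subset G -> F = G.
Proof.
move=> [hF rF] hG GX sFG; apply/eqP; rewrite eqEsubset sFG /=; apply/subsetP => i iG.
have [l [l0 lG lX]] := cface_form hG.
have sGX := cface_sub hG.
have [j jX jG] : exists2 j, j \in X & j \notin G.
  by apply/subsetPn; apply: contra GX => sXG; rewrite eqEsubset sGX.
have rGX : (rk G < rk X)%N by apply: (rk_lt sGX lG jX); rewrite gt_eqF ?lX.
apply/negPn/negP => iF.
have [m [m0 mF mX]] := cface_form hF.
have := rk_lt sFG mF iG; rewrite gt_eqF ?mX ?(subsetP sGX) // => /(_ isT); lia.
Qed.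

(* Adding a multiple of [m] to [l] until a new zero appears. *)
Lemma tilt_form X l m j : (forall i, i \in X -> 0 <= ev l (v i)) ->
  (forall i, i \in X -> ev l (v i) = 0 -> 0 <= ev m (v i)) ->
  j \in X -> ev m (v j) < 0 ->
  exists c, [/\ 0 < c, forall i, i \in X -> 0 <= ev l (v i) + c * ev m (v i) &
    exists i, [/\ i \in X, ev m (v i) < 0 & ev l (v i) + c * ev m (v i) = 0]].
Proof.
move=> l0 lm jX mj; pose P i := (i \in X) && (ev m (v i) < 0).
pose f i := ev l (v i) / - ev m (v i).
have Pj : P j by rewrite /P jX.
have [i /andP[iX mi] fi] := @Order.TotalTheory.arg_minP _ R I j P f Pj.
have li : 0 < ev l (v i).
  rewrite lt_neqAle l0 // andbT eq_sym; apply/eqP => /(lm _ iX); lra.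
exists (f i); split.
- by rewrite divr_gt0 // oppr_gt0.
- move=> k kX; have [mk|mk] := ltP (ev m (v k)) 0; last first.
    by rewrite addr_ge0 ?l0 // mulr_ge0 // divr_ge0 ?l0 // oppr_ge0 ltW.
  have : f i <= f k by apply: fi; rewrite /P kX.
  rewrite -(@ler_pM2r _ (- ev m (v k))) ?oppr_gt0 // [X in _ <= X]divfK; last first.
    by rewrite oppr_eq0 lt_eqF.
  by rewrite mulrN; lra.
- exists i; split=> //; rewrite /f invrN mulrN mulNr divfK ?lt_eqF //; lra.
Qed.

(** If [F] has corank above 1, then [i |: F] does not span, and some form [m] vanishes on it.
    Tilting the form of [F] by [m] enlarges the face and leaves the positive value at [i] unchanged;
    this stops at a facet. *)
Lemma facet_sep X F i : cface X F -> i \in X -> i \notin F ->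
  exists G, [/\ facet X G, F \subset G & i \notin G].
Proof.
have [n] := ubnP #|X :\: F|; elim: n F => // n IH F ltF hF iX iF.
have [l [l0 lF lX]] := cface_form hF.
have sFX := cface_sub hF.
have li := lX _ iX iF.
have rFX : (rk F < rk X)%N by apply: (rk_lt sFX lF iX); rewrite gt_eqF.
have [rF|rF] := eqVneq (rk F).+1 (rk X); first by exists F.
have /form_of_rk_lt[m [j [jX mF mj]]] : (rk (i |: F) < rk X)%N.
  apply: leq_ltn_trans (rkU1 _ _) _; lia.
have {m mF mj} [m [mF mj]] : exists m,
    (forall k, k \in i |: F -> ev m (v k) = 0) /\ ev m (v j) < 0.
  have [mj0|mj0] := ltP (ev m (v j)) 0; first by exists m.
  exists (- m); split=> [k kF|]; first by rewrite ev_oppf mF // oppr0.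
  by rewrite ev_oppf oppr_lt0 lt_neqAle eq_sym mj.
have mi : ev m (v i) = 0 by rewrite mF // setU11.
have mF' k : k \in F -> ev m (v k) = 0 by move=> kF; rewrite mF // setU1r.
have [k kX kl|c [c0 h [k [kX mk hk]]]] := tilt_form l0 _ jX mj.
  case: (boolP (k \in F)) => [/mF' -> //|/(lX _ kX)]; lra.
pose G := [set k in X | ev (l + c *: m) (v k) == 0].
have hG : cface X G by exists (l + c *: m); split=> // p pX; rewrite !evE h.
have sFG : F \subset G.
  apply/subsetP => p pF; rewrite inE (subsetP sFX) // !evE lF // mF' //.
  by rewrite mulr0 addr0 eqxx.
have iG : i \notin G by rewrite inE iX !evE mi mulr0 addr0 gt_eqF.
have kG : k \in G by rewrite inE kX !evE hk eqxx.
have kF : k \notin F by apply: contraTN mk => /mF' ->; rewrite ltxx.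
have [||||H [fH sGH iH]] := IH G => //.
  rewrite -ltnS; apply: leq_trans ltF; rewrite ltnS; apply: proper_card.
  apply/properP; split; first exact: setDS.
  by exists k; rewrite inE kX ?kF // kG.
by exists H; split=> //; exact: subset_trans sGH.
Qed.

(** * Convex position: vertices, edges and degrees *)

Definition convex_position X := forall i, i \in X -> cface X [set i].

Lemma convex_position_sub X Y : convex_position X -> Y \subset X -> convex_position Y.
Proof.
by move=> h sYX i iY; apply: (cface_subset (h i _)) => //; rewrite ?sub1set // (subsetP sYX).
Qed.

Lemma cface_set0 X : convex_position X -> (1 < #|X|)%N -> cface X set0.
Proof.
move=> h /card_gt1P[i [j [iX jX ij]]].
have -> : set0 = [set i] :&: [set j].
  by apply/setP => k; rewrite !inE; case: eqP => // ->; rewrite (negPf ij).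
by apply: cfaceI; exact: h.
Qed.

Lemma rk_ge2 X : convex_position X -> (1 < #|X|)%N -> (1 < rk X)%N.
Proof.
move=> h /card_gt1P[i [j [iX jX ij]]].
have sijX : [set i; j] \subset X by rewrite subUset !sub1set iX.
have e2 : #|[set i; j]| = 2%N by rewrite cards2 ij.
apply: leq_trans (rk_mono sijX); rewrite -e2.
apply: card_le_rk => k kij.
have [p pX [kp hp]] : exists2 p, p \in X & k != p /\ forall q, q \in [set i; j] :\ k -> q = p.
  case/set2P: kij => ->; [exists j|exists i] => //; split=> //; rewrite 1?eq_sym // => q;
  by rewrite !inE => /andP[/negPf ->] /=; rewrite ?orbF => /eqP.
have [l [l0 lF lX]] := cface_form (h p pX); exists l; split=> [q /hp ->|].
  by rewrite lF // set11.
by rewrite gt_eqF // lX ?inE // (subsetP sijX).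
Qed.

(** If a third vertex were a combination of two others, the forms exposing these two would make both
    coefficients positive, and the form exposing the third could not vanish there. *)
Lemma card_le2 X : convex_position X -> (rk X <= 2)%N -> (#|X| <= 2)%N.
Proof.
move=> h rX; rewrite leqNgt; apply/card_gt2P => -[i [j [k [[iX jX kX] [ij jk ki]]]]].
have sijX : [set i; j] \subset X by rewrite subUset !sub1set iX.
have rij : (1 < rk [set i; j])%N.
  by apply: rk_ge2; rewrite ?cards2 ?ij //; exact: convex_position_sub sijX.
have /eqP eij : span_of [set i; j] == span_of X.
  by rewrite eqEdim span_mono //= (leq_trans rX).
have := mem_span kX; rewrite -eij => /span_comb[c].
rewrite big_setU1 /= ?inE // big_set1 => ek.
have pos p q : p \in X -> q \in X -> p != q -> exists l,
    [/\ forall i, i \in X -> 0 <= ev l (v i), ev l (v p) = 0 & 0 < ev l (v q)].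
  move=> pX qX pq; have [l [l0 lF lX]] := cface_form (h p pX).
  by exists l; split=> //; [rewrite lF ?inE|apply: lX => //; rewrite inE eq_sym].
have key l : ev l (v k) = c i * ev l (v i) + c j * ev l (v j) by rewrite ek !evE.
have [l' [l'0 l'i l'k]] := pos i k iX kX (contra_neq esym ki).
have [l'' [l''0 l''j l''k]] := pos j k jX kX jk.
have [n [n0 nk ni]] := pos k i kX iX ki.
have := key l'; rewrite l'i mulr0 add0r => e1.
have := key l''; rewrite l''j mulr0 addr0 => e2.
have cj : 0 < c j.
  have := l'0 j jX; rewrite le0r => /orP[/eqP e|lj]; last by rewrite e1 pmulr_lgt0 in l'k.
  by move: l'k; rewrite e1 e mulr0 ltxx.
have ci : 0 < c i.
  have := l''0 i iX; rewrite le0r => /orP[/eqP e|lj]; last by rewrite e2 pmulr_lgt0 in l''k.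
  by move: l''k; rewrite e2 e mulr0 ltxx.
have := key n; rewrite nk; have := mulr_gt0 ci ni; have := mulr_ge0 (ltW cj) (n0 _ jX); lra.
Qed.

(** By descent to a facet through [i] that avoids [j]. *)
Lemma edge_at X i j : convex_position X -> i \in X -> j \in X -> j != i ->
  exists k, [/\ k \in X, k != i & cface X [set i; k]].
Proof.
have [n] := ubnP #|X|; elim: n X j => // n IH X j ltX hX iX jX ji.
have [|G [[fG rG] siG jG]] := facet_sep (hX i iX) jX; first by rewrite inE.
have iG : i \in G by move: siG; rewrite sub1set.
(* A facet reduced to one vertex forces rank at most 2, and then [X] itself is the edge. *)
have [e|GN] := eqVneq G [set i].
  exists j; split=> //; suff -> : [set i; j] = X by exact: cfacexx.
  apply/eqP; rewrite eqEcard subUset !sub1set iX jX cards2 eq_sym ji /=.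
  by apply: card_le2 => //; rewrite -rG ltnS e (leq_trans (rk_le_card _)) ?cards1.
have [k kG ki] : exists2 k, k \in G & k != i.
  have /subsetPn[k kG] : ~~ (G \subset [set i]).
    by apply: contra GN => sG; rewrite eqEsubset sG siG.
  by rewrite inE; exists k.
have sGX := cface_sub fG.
have [|p [pG pi hp]] := IH G k _ (convex_position_sub hX sGX) iG kG ki.
  rewrite -ltnS; apply: leq_trans ltX; rewrite ltnS; apply: proper_card.
  by apply/properP; split=> //; exists j.
by exists p; split=> //; [exact: (subsetP sGX)|exact: cface_trans hp].
Qed.

Definition nbrs X i := [set j in X | (j != i) && `[< cface X [set i; j] >]].

(** If [i] and its neighbours did not span, a form vanishing on them would tilt the form exposing
    [i] into a face that contains [i] and other vertices but no neighbour of [i], against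
    [edge_at]. *)
Lemma degree_ge X i : convex_position X -> i \in X -> (rk X <= #|nbrs X i|.+1)%N.
Proof.
move=> hX iX; rewrite leqNgt; apply/negP => hlt.
have /form_of_rk_lt[m [w [wX mF mw]]] : (rk (i |: nbrs X i) < rk X)%N.
  by apply: leq_ltn_trans (rkU1 _ _) (leq_ltn_trans _ hlt); rewrite ltnS rk_le_card.
have {m mF mw} [m [mF mw]] : exists m,
    (forall k, k \in i |: nbrs X i -> ev m (v k) = 0) /\ ev m (v w) < 0.
  have [mw0|mw0] := ltP (ev m (v w)) 0; first by exists m.
  exists (- m); split=> [k kF|]; first by rewrite ev_oppf mF // oppr0.
  by rewrite ev_oppf oppr_lt0 lt_neqAle eq_sym mw.
have [l [l0 lF lX]] := cface_form (hX i iX).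
have mi : ev m (v i) = 0 by rewrite mF // setU11.
have [k kX kl|c [c0 h [k [kX mk hk]]]] := tilt_form l0 _ wX mw.
  have [->|ki] := eqVneq k i; first by rewrite mi.
  by have := lX _ kX; rewrite inE => /(_ ki); lra.
pose G := [set k in X | ev (l + c *: m) (v k) == 0].
have hG : cface X G by exists (l + c *: m); split=> // p pX; rewrite !evE h.
have iG : i \in G by rewrite inE iX !evE mi lF ?set11 // mulr0 addr0 eqxx.
have kG : k \in G by rewrite inE kX !evE hk eqxx.
have ki : k != i by apply: contraTneq mk => ->; rewrite mi ltxx.
have [p [pG pi hp]] := edge_at (convex_position_sub hX (cface_sub hG)) iG kG ki.
have : p \in nbrs X i.
  by rewrite inE pi (subsetP (cface_sub hG)) //=; apply/asboolP; exact: cface_trans hp.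
move=> pN; have pX := subsetP (cface_sub hG) _ pG.
have := lX p pX; rewrite inE => /(_ pi).
by move: pG; rewrite inE pX !evE mF ?setU1r // mulr0 addr0 => /eqP ->; rewrite ltxx.
Qed.

(** * Counting edges *)

Definition edges X := [set e : {set I} | (#|e| == 2%N) && `[< cface X e >]].

Definition edges_meeting X Y := [set e in edges X | ~~ [disjoint e & Y]].

(** The edges from [i] to neighbours outside [Y] are disjoint from [Y], hence newly counted. *)
Lemma edges_meetingU1 X Y i : i \notin Y ->
  (#|edges_meeting X Y| + #|nbrs X i :\: Y| <= #|edges_meeting X (i |: Y)|)%N.
Proof.
move=> iY; pose f j := [set i; j].
have f_inj : {in nbrs X i :\: Y &, injective f}.
  move=> j k; rewrite !inE => /and3P[_ _ /andP[ji _]] _ /setP/(_ j).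
  by rewrite /f !inE eqxx orbT (negPf ji) => /esym/eqP.
rewrite -(card_in_imset f_inj) -cardsUI.
rewrite [X in (_ + #|pred_of_set X|)%N](_ : _ = set0) ?cards0 ?addn0; last first.
  apply/setP => e; rewrite [RHS]inE; apply/negP => /setIP[]; rewrite inE => /andP[_ eY].
  case/imsetP => j; rewrite !inE => /and3P[jY _ _] ee; case/negP: eY.
  rewrite ee -setI_eq0; apply/eqP/setP => k; rewrite !inE.
  case: eqP => [->|_] /=; first by rewrite (negPf iY).
  by case: eqP => // ->; rewrite (negPf jY).
apply: subset_leq_card; apply/subsetP => e /setUP[].
  rewrite !inE => /andP[-> ]; rewrite -!setI_eq0 /=; apply: contraNN => /eqP/setP h.
  by apply/eqP/setP => k; have := h k; rewrite !inE; case: (k \in e) => //=; case: (k == i).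
case/imsetP => j; rewrite !inE => /and3P[_ _ /andP[ji /asboolP hj]] ->.
rewrite cards2 (eq_sym i) ji /=; apply/andP; split; first exact/asboolP.
by rewrite -setI_eq0; apply/set0Pn; exists i; rewrite !inE eqxx.
Qed.

(** Each vertex added brings at least [d] edges, at most one per earlier vertex being already
    counted; these overlaps add up to the binomial. *)
Lemma edges_meeting_ge X Y d : convex_position X -> rk X = d.+1 -> Y \subset X ->
  (d * #|Y| <= #|edges_meeting X Y| + 'C(#|Y|, 2))%N.
Proof.
move=> hX rX; have [n] := ubnP #|Y|; elim: n Y => // n IH Y ltY sYX.
have [->|/set0Pn[i iY]] := eqVneq Y set0; first by rewrite cards0 muln0.
have hY : Y :\ i \subset X by exact: subset_trans (subD1set _ _) sYX.
have cY : #|Y| = #|Y :\ i|.+1 by rewrite (cardsD1 i Y) iY.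
have iYi : i \notin Y :\ i by rewrite !inE eqxx.
have := IH (Y :\ i); rewrite -ltnS -cY => /(_ ltY hY).
have := edges_meetingU1 X iYi; rewrite setD1K //.
have := degree_ge hX (subsetP sYX _ iY); rewrite rX ltnS.
have := cardsID (Y :\ i) (nbrs X i).
have := subset_leq_card (subsetIr (nbrs X i) (Y :\ i)).
rewrite cY binS bin1 mulnS; lia.
Qed.

Lemma edges_face X F : cface X F ->
  (#|edges F| + #|edges_meeting X (X :\: F)| <= #|edges X|)%N.
Proof.
move=> hF; rewrite -cardsUI.
rewrite [X in (_ + #|pred_of_set X|)%N](_ : _ = set0) ?cards0 ?addn0; last first.
  apply/setP => e; rewrite [RHS]inE; apply/negP => /setIP[]; rewrite !inE.
  case/andP=> _ /asboolP/cface_sub/subsetP eF /andP[_]; rewrite -setI_eq0 => /set0Pn[k].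
  by rewrite !inE => /and3P[/eF ->].
apply: subset_leq_card; apply/subsetP => e /setUP[]; rewrite !inE.
  by case/andP=> -> /asboolP h; apply/asboolP; exact: cface_trans h.
by case/andP.
Qed.

Lemma facet_card X F : convex_position X -> facet X F -> (rk X <= #|F|.+1)%N.
Proof. by move=> hX [hF <-]; rewrite ltnS rk_le_card. Qed.

Lemma cardD_cface X F : cface X F -> (#|F| + #|X :\: F|)%N = #|X|.
Proof. by move=> /cface_sub h; rewrite -{1}(setIidPr h) cardsID. Qed.

Lemma bin2_mul2 m : ('C(m, 2) * 2 = m * m.-1)%N.
Proof. by elim: m => // m IH; rewrite binS bin1 mulnDl IH /=; nia. Qed.

(** If every facet missed a single vertex, facet forms would isolate all vertices, and [card_le_rk]
    would bound their number by the rank. *)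
Lemma nontrivial_facet X d : convex_position X -> rk X = d.+1 -> (d.+1 < #|X|)%N ->
  exists F, facet X F /\ (1 < #|X :\: F|)%N.
Proof.
move=> hX rX cX; apply: contrapT => hno.
suff : (#|X| <= rk X)%N by rewrite rX leqNgt cX.
apply: card_le_rk => i iX.
have [|F [hF _ iF]] := facet_sep (cface_set0 hX _) iX (negbT (in_set0 i)).
  by lia.
have /cards1P[j ej] : #|X :\: F| == 1%N.
  apply/eqP/anti_leq/andP; split.
    by rewrite leqNgt; apply/negP => h; apply: hno; exists F.
  by apply/card_gt0P; exists i; rewrite inE iF.
have [l [l0 lF lX]] := cface_form (facet_face hF); exists l; split.
  move=> p /setD1P[pi pX]; apply: lF; apply: contraNT pi => pF.
  have : i \in X :\: F by rewrite inE iF.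
  have : p \in X :\: F by rewrite inE pF.
  by rewrite ej !inE => /eqP -> /eqP ->.
by rewrite gt_eqF ?lX.
Qed.

(** The bound [phi (d + k) d], free of subtraction. A facet missing [n] vertices exceeds its
    dimension by [k - n + 1] vertices, so the induction on [d] changes [k] too. *)
Theorem edges_lower_bound X d k : convex_position X -> rk X = d.+1 ->
  #|X| = (d + k)%N -> (1 <= k <= d)%N ->
  (d * d <= #|edges X| + 'C(d.+1 - k, 2))%N.
Proof.
elim: d X k => [|d IH] X k hX rX cX /andP[k1 kd]; first by move: k1; rewrite ltnNge kd.
have [k2|k2] := ltnP 1 k; last first.
  have := edges_meeting_ge hX rX (subxx X).
  have : (#|edges_meeting X X| <= #|edges X|)%N.
    by apply: subset_leq_card; apply/subsetP => e; rewrite inE => /andP[].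
  have {k1 k2 kd} ? : k = 1%N by lia.
  subst k; rewrite cX.
  have := bin2_mul2 (d.+1 + 1); have := bin2_mul2 (d.+2 - 1).
  rewrite subn1 addn1 /=; nia.
have [|F [hF nF]] := nontrivial_facet hX rX; first by lia.
have := facet_card hX hF; rewrite rX ltnS => cF.
have eF := cardD_cface (facet_face hF).
have rF : rk F = d.+1 by case: hF => _; rewrite rX => -[].
have := IH F (#|F| - d)%N (convex_position_sub hX (cface_sub (facet_face hF))) rF.
have := edges_meeting_ge hX rX (subsetDl X F).
have := edges_face (facet_face hF).
rewrite cX in eF.
set n := #|X :\: F| in eF nF *; set eX := #|edges X|; set eM := #|edges_meeting _ _|; set eFF := #|edges F|.
move=> h1 h2 h3; have {h3} := h3 ltac:(lia) ltac:(lia).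
have [a ea] : exists a, d.+1 = (k + a)%N by exists (d.+1 - k)%N; lia.
have [p ep] : exists p, n = p.+2 by exists (n - 2)%N; lia.
have [q eq] : exists q, k = (n + q)%N by exists (k - n)%N; lia.
have -> : (d.+1 - (#|F| - d) = a.+1 + p)%N by lia.
have -> : (d.+2 - k = a.+1)%N by lia.
have := bin2_mul2 n; have := bin2_mul2 (a.+1 + p); have := bin2_mul2 a.+1.
rewrite ep addSn /= in h1 h2 eq *.
have ed : d = (p + q + a).+1 by lia.
move: h1 h2; rewrite {}ed; clearbody eX eM eFF.
(* With [p = n - 2] and [q = k - n], the three estimates combine to the bound with surplus exactly
   [p * q]. *)
move: 'C(_, _) 'C(_, _) 'C(_, _) => x y z; have : (0 <= p * q)%N by [].
lia.
Qed.
(** The source of extra edges in both surplus arguments below. A form exposing [j] keeps its values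
    on the base when a multiple of the form of the base is subtracted. *)
Lemma pyramid_edge X F G i j : convex_position X -> cface X F -> cface F G ->
  F = i |: G -> i \notin G -> j \in G -> cface X [set i; j].
Proof.
move=> hX hF hG eF iG jG; apply: (cface_trans hF).
have sGF := subsetP (cface_sub hG); have sFX := subsetP (cface_sub hF).
have iF : i \in F by rewrite eF setU11.
have [l [l0 lG lF]] := cface_form hG.
have [m [m0 mj mX]] := cface_form (hX j (sFX _ (sGF _ jG))).
have li := lF i iF iG.
have ij : i != j by apply: contraNneq iG => ->.
(* The form [m - c l], with [c] chosen so that it also vanishes at the apex. *)
pose c := ev m (v i) / ev l (v i).
apply: (@cface_of_form _ _ (m - c *: l)).
- by apply/subsetP => k /set2P[] ->; rewrite // sGF.
- move=> k /set2P[] ->; rewrite !evE; last by rewrite mj ?set11 // lG // mulr0 subr0.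
  by rewrite /c divfK ?gt_eqF // subrr.
- move=> k kF; rewrite !inE negb_or => /andP[ki kj]; rewrite !evE.
  have kG : k \in G by move: kF; rewrite eF !inE (negPf ki).
  by rewrite lG // mulr0 subr0 mX ?sFX // inE.
Qed.

Lemma card_setD2 X i j : i != j -> i \in X -> j \in X -> (#|X :\: [set i; j]| + 2 = #|X|)%N.
Proof.
move=> ij iX jX; have := cardsID [set i; j] X.
by rewrite (setIidPr _) ?subUset ?sub1set ?iX // cards2 ij addnC.
Qed.

(** Independence provides a form vanishing on all of [S] except [i]; up to sign it is positive
    there. *)
Lemma simplex_facet_ridge X S i : cface X S -> rk S = #|S| -> i \in S -> cface X (S :\ i).
Proof.
move=> hS rS iS; apply: (cface_trans hS).
have /form_of_rk_lt[l [j [jS l0 lj]]] : (rk (S :\ i) < rk S)%N.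
  by apply: leq_ltn_trans (rk_le_card _) _; rewrite rS (cardsD1 i S) iS.
have {j jS lj} li : ev l (v i) != 0.
  have [ji|ji] := eqVneq j i; first by rewrite -ji.
  by move: lj; rewrite l0 ?eqxx // !inE ji.
wlog li0 : l l0 li / 0 < ev l (v i).
  move=> h; have [l1|l1] := ltP 0 (ev l (v i)); first exact: (h l).
  apply: (h (- l)) => [j /l0||]; rewrite ev_oppf.
  - by move=> ->; rewrite oppr0.
  - by rewrite oppr_eq0.
  - by rewrite oppr_gt0 lt_neqAle li.
apply: (cface_of_form (subD1set _ _) l0) => j jS.
by rewrite !inE jS andbT negbK => /eqP ->.
Qed.

(** Arithmetic for two simplex facets [S] and [t |: (S :\ s)]: [eT] counts the edges meeting the
    other [k - 1] vertices outside [S], and [nS] those from [t] to [S :\ s]. Degrees alone credit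
    [t] with [d - (k - 1)] further edges, so [d - 1] of them gain [k - 2]. *)
Lemma switched_edge_count d k eX eS eT nS : (4 <= k)%N -> (k <= d)%N ->
  (eX + 'C(d.+1 - k, 2) < d * d + (k - 3))%N ->
  (d * k.-1 <= eT + 'C(k.-1, 2))%N -> (d.-1 <= nS)%N -> (eT + nS <= eS)%N ->
  (d.-1 * d.-1 + eS <= eX + 'C(d.-1 + k - k, 2))%N -> False.
Proof.
move=> k4 kd.
have [p ep] : exists p, k = p.+4 by exists (k - 4)%N; lia.
have [a ea] : exists a, d = (p + a + 4)%N by exists (d - k)%N; lia.
have -> : (d.+1 - k = a.+1)%N by lia.
have -> : (d.-1 + k - k = a + p.+3)%N by lia.
have := bin2_mul2 k.-1; have := bin2_mul2 (a + p.+3); have := bin2_mul2 a.+1.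
have -> : d.-1 = (p + a + 3)%N by lia.
rewrite {}ea {}ep addnS /=.
move: 'C(_, _) 'C(_, _) 'C(_, _) => x y z; lia.
Qed.

(** * Structure of a configuration with too few edges *)

Section FewEdges.
Variables (X : {set I}) (d k : nat).
Hypotheses (hX : convex_position X) (rX : rk X = d.+1) (cX : #|X| = (d + k)%N).
Hypotheses (k4 : (4 <= k)%N) (kd : (k <= d)%N).

Lemma facet_cardD F : facet X F -> (0 < #|X :\: F| <= k)%N /\ (#|F| + #|X :\: F| = d + k)%N.
Proof.
move=> hF; have := facet_card hX hF; rewrite rX ltnS => cF.
have := cardD_cface (facet_face hF); rewrite cX => eF; split=> //.
apply/andP; split; last by lia.
rewrite card_gt0; apply/eqP => eXF; case: hF => _ /eqP; rewrite rX eqSS => /eqP rF.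
have : X \subset F by rewrite -setD_eq0 eXF.
by move/rk_mono; rewrite rX rF ltnn.
Qed.

Lemma facet_edges F : facet X F -> (1 < #|X :\: F|)%N ->
  (d.-1 * d.-1 + #|edges_meeting X (X :\: F)| <= #|edges X| + 'C(d.-1 + #|X :\: F| - k, 2))%N.
Proof.
move=> hF n2; have [n1 eF] := facet_cardD hF.
have hF' := facet_face hF; have sFX := cface_sub hF'.
have rF : rk F = d.-1.+1 by case: hF => _; rewrite rX; lia.
have := @edges_lower_bound F d.-1 (#|F| - d.-1) (convex_position_sub hX sFX) rF.
have := edges_face hF'.
have -> : (d.-1.+1 - (#|F| - d.-1) = d.-1 + #|X :\: F| - k)%N by lia.
move=> h1 h2; have := h2 ltac:(lia) ltac:(lia); lia.
Qed.

Hypothesis few : (#|edges X| + 'C(d.+1 - k, 2) < d * d + (k - 3))%N.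

Lemma facet_cardD_cases F : facet X F -> [|| #|X :\: F| == 1, #|X :\: F| == 2 | #|X :\: F| == k]%N.
Proof.
move=> hF; have [/andP[n1 nk] eF] := facet_cardD hF.
apply/negPn/negP => hno.
have := facet_edges hF; have := edges_meeting_ge hX rX (subsetDl X F).
move: few; set n := #|X :\: F| in n1 nk eF hno *.
have [a ea] : exists a, d = (k + a)%N by exists (d - k)%N; lia.
(* So chosen that the surplus [(n - 2)(k - n)] reads [p * q + (k - 3)]. *)
have [p ep] : exists p, n = p.+3 by exists (n - 3)%N; lia.
have [q eq] : exists q, k = (p + q + 4)%N by exists (k - n - 1)%N; lia.
have -> : (d.+1 - k = a.+1)%N by lia.
have -> : (d.-1 + n - k = a + p.+2)%N by lia.
have := bin2_mul2 n; have := bin2_mul2 (a + p.+2); have := bin2_mul2 a.+1.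
have -> : d.-1 = (p + q + a + 3)%N by lia.
have -> : d = (p + q + a + 4)%N by lia.
rewrite {}eq {}ep addnS /=.
move: 'C(_, _) 'C(_, _) 'C(_, _) #|edges X| #|_| => x y z eX eM h1 h2 h3 h4 h5 /(_ isT) h6.
have : (0 <= p * q)%N by []; lia.
Qed.

(** The facets meet in a face [W], and [X :\: [set x; z]] is a pyramid over [W] with apex [y]. So
    [y] has [d + k - 3] neighbours in [W], and at least [2d + k - 3] edges meet [{x, y}], where
    degrees alone give [2d - 1]. *)
Lemma cofacet_pair_disjoint x y z : x \in X -> x != y -> x != z ->
  y \in X -> z \in X ->
  facet X (X :\: [set x; y]) -> facet X (X :\: [set x; z]) -> y = z.
Proof.
move=> xX xy xz yX zX hy hz; apply/eqP/negPn/negP => yz.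
pose W := X :\: [set x; y; z].
have hW : cface X W.
  have -> : W = (X :\: [set x; y]) :&: (X :\: [set x; z]).
    by apply/setP => i; rewrite !inE; case: (i \in X); case: (i == x); case: (i == y); case: (i == z).
  by apply: cfaceI; exact: facet_face.
have eW : X :\: [set x; z] = y |: W.
  apply/setP => i; rewrite !inE; case: (i =P y) => [->|_]; last by rewrite orbF.
  by rewrite yX eq_sym (negPf xy) (negPf yz).
have yW : y \notin W by rewrite !inE eqxx orbT.
have sW : W \subset nbrs X y :\: [set x].
  apply/subsetP => i iW; rewrite !inE.
  have := iW; rewrite !inE => /andP[]; rewrite !negb_or => /andP[/andP[-> ->] _] -> /=.
  apply/asboolP; apply: (pyramid_edge hX (facet_face hz) _ eW yW iW).
  by apply: (cface_subset hW); rewrite ?eW ?subsetUr // -eW subsetDl.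
have cW : (#|W| + 3 = d + k)%N.
  by rewrite -cX -(card_setD2 xz xX zX) eW cardsU1 yW; lia.
have exy : X :\: (X :\: [set x; y]) = y |: [set x].
  by rewrite setDDr setDv set0U (setIidPr _) ?subUset ?sub1set ?xX // setUC.
have nxy : #|y |: [set x]| = 2%N by rewrite cardsU1 cards1 inE eq_sym xy.
have := facet_edges hy; rewrite exy nxy => /(_ isT).
have := edges_meetingU1 X (_ : y \notin [set x]); rewrite inE eq_sym => /(_ xy).
have := subset_leq_card sW.
have := edges_meeting_ge hX rX (_ : [set x] \subset X); rewrite sub1set cards1 => /(_ xX).
move: few; have -> : (d.-1 + 2 - k = d.+1 - k)%N by lia.
have [e ee] : exists e, d = e.+1 by exists d.-1; lia.
rewrite ee (@bin_small 1 2) //=; move: 'C(_, _) => b.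
lia.
Qed.

(** If a facet misses just [{x, y}], take a facet through [x] avoiding [y]. Missing [y] alone, it
    would properly contain the first; missing another pair, it would contradict
    [cofacet_pair_disjoint]. *)
Lemma simplex_facet_exists : exists S, facet X S /\ #|X :\: S| = k.
Proof.
have [|F [hF n2]] := nontrivial_facet hX rX; first by lia.
have /or3P[/eqP h|/eqP h|/eqP h] := facet_cardD_cases hF; [lia| |by exists F].
have sFX := cface_sub (facet_face hF).
have /cards2P[x [y [xy exy]]] : #|X :\: F| == 2%N by rewrite h.
have [xX yX] : x \in X /\ y \in X.
  by split; apply: (subsetP (subsetDl X F)); rewrite exy !inE eqxx ?orbT.
have eF : F = X :\: [set x; y] by rewrite -exy setDDr setDv set0U (setIidPr sFX).
have [|G [hG sxG yG]] := facet_sep (hX xX) yX; first by rewrite inE eq_sym.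
have sGX := cface_sub (facet_face hG).
have xG : x \in G by rewrite sub1set in sxG.
have yXG : y \in X :\: G by rewrite inE yG.
exists G; split=> //.
have /or3P[/cards1P[z ez]|/cards2P[z [t [zt ezt]]]|/eqP //] := facet_cardD_cases hG.
  have ezy : z = y by move: yXG; rewrite ez => /set1P.
  suff : F = G by move=> eFG; move: xG; rewrite -eFG eF !inE eqxx.
  apply: (facet_subset_eq hF (facet_face hG)).
    by apply: contraNneq yG => ->.
  have -> : G = X :\ y by rewrite -ezy -ez setDDr setDv set0U (setIidPr sGX).
  by rewrite eF setDS // sub1set !inE eqxx orbT.
have [u [yu eXG]] : exists u, y != u /\ X :\: G = [set y; u].
  by move: yXG; rewrite ezt => /set2P[] ->; [exists t|exists z; rewrite eq_sym setUC].
have eG : G = X :\: [set y; u] by rewrite -eXG setDDr setDv set0U (setIidPr sGX).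
have uX : u \in X by apply: (subsetP (subsetDl X G)); rewrite eXG !inE eqxx orbT.
have : x = u.
  apply: (@cofacet_pair_disjoint y) => //; rewrite -?eG // 1?eq_sym // setUC -eF //.
by move=> exu; move: xG; rewrite eG -exu !inE eqxx orbT.
Qed.

Variable S : {set I}.
Hypotheses (hS : facet X S) (cXS : #|X :\: S| = k).

Lemma card_simplex_facet : #|S| = d.
Proof. by have [_] := facet_cardD hS; rewrite cXS; lia. Qed.

Lemma rk_simplex_facet : rk S = d.
Proof. by case: hS => _; rewrite rX => -[]. Qed.

Lemma ridge_facet_cases s : s \in S ->
  facet X (X :\ s) \/ exists t, t \in X :\: S /\ facet X (X :\: [set s; t]).
Proof.
move=> sS; have sSX := subsetP (cface_sub (facet_face hS)).
have hSs : cface X (S :\ s).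
  by apply: simplex_facet_ridge sS; [exact: facet_face|rewrite rk_simplex_facet card_simplex_facet].
have [|F [hF sSF sF]] := facet_sep hSs (sSX _ sS); first by rewrite !inE eqxx.
have sFX := cface_sub (facet_face hF).
have eF Y : X :\: F = Y -> F = X :\: Y.
  by move=> <-; rewrite setDDr setDv set0U (setIidPr sFX).
have sXF : s \in X :\: F by rewrite inE sF sSX.
have notS t : t \in X :\: F -> t != s -> t \in X :\: S.
  rewrite !inE => /andP[tF ->] ts; rewrite andbT; apply: contra tF => tS.
  by apply: (subsetP sSF); rewrite !inE ts.
have /or3P[/cards1P[z ez]|/cards2P[z [t [zt ezt]]]|/eqP cF] := facet_cardD_cases hF.
- by left; move: sXF; rewrite ez => /set1P ->; rewrite -(eF _ ez).
- right; move: (sXF); rewrite ezt => /set2P[] es; [exists t|exists z].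
    by rewrite notS ?es ?ezt ?inE ?eqxx ?orbT 1?eq_sym // -(eF _ ezt).
  by rewrite notS ?es ?ezt ?inE ?eqxx ?orbT // setUC -(eF _ ezt).
(* By cardinality [F] is [S :\ s] plus one vertex [t], a pyramid with apex [t]. *)
- exfalso; have [_] := facet_cardD hF; rewrite cF => cFd.
  have cSs : (#|S :\ s|.+1 = d)%N by rewrite -card_simplex_facet (cardsD1 s S) sS.
  have /cards1P[t et] : #|F :\: (S :\ s)| == 1%N.
    by rewrite -(eqn_add2l #|S :\ s|) addn1 cSs -(addIn cFd) -(cardsID (S :\ s) F) (setIidPr sSF).
  have tF : t \in F :\: (S :\ s) by rewrite et set11.
  have {tF} [tF tSs] : t \in F /\ t \notin S :\ s by move: tF; rewrite inE => /andP[].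
  have eFt : F = t |: (S :\ s).
    apply/esym/eqP; by rewrite eqEcard subUset sub1set tF sSF cardsU1 tSs (addIn cFd) add1n cSs /=.
  have ts : t != s by apply: contraNneq sF => <-.
  have tX : t \in X := subsetP sFX _ tF.
  have tS : t \notin S by move: tSs; rewrite !inE ts.
  pose T := X :\: S; have tT : t \in T by rewrite inE tS.
  have sub : S :\ s \subset nbrs X t :\: (T :\ t).
    apply/subsetP => i iSs; have := iSs; rewrite !inE => /andP[nis iS].
    have iX := sSX _ iS; rewrite iX iS /= andbF /= (contraNneq _ tS) ?andbT; last by move=> <-.
    apply/asboolP; apply: (pyramid_edge hX (facet_face hF) _ eFt tSs iSs).
    exact: cface_subset hSs sSF sFX.
  have := facet_edges hS; rewrite cXS => /(_ (@ltn_trans 3 1 k isT k4)).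
  have := edges_meetingU1 X (_ : t \notin T :\ t); rewrite setD1K // !inE eqxx => /(_ isT).
  have := subset_leq_card sub.
  have sTX : T :\ t \subset X by rewrite (subset_trans (subD1set _ _)) ?subsetDl.
  have := edges_meeting_ge hX rX sTX.
  have -> : #|T :\ t| = k.-1 by rewrite -cXS -/T (cardsD1 t T) tT.
  have -> : #|S :\ s| = d.-1 by rewrite -card_simplex_facet (cardsD1 s S) sS.
  rewrite -/T => h1 h2 h3 h4; exact: switched_edge_count k4 kd few h1 h2 h3 h4.
Qed.

(** A fixed point of [tau] encodes an apex; otherwise [s] and [tau s] will be the ends of a vertical
    edge of the prism. *)
Lemma matching_exists : exists tau : I -> I, forall s, s \in S ->
  (tau s = s /\ facet X (X :\ s)) \/
  (tau s \in X :\: S /\ facet X (X :\: [set s; tau s])).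
Proof.
have /choice[tau h] : forall s, exists t, s \in S -> (t = s /\ facet X (X :\ s)) \/
    (t \in X :\: S /\ facet X (X :\: [set s; t])).
  move=> s; case: (boolP (s \in S)) => [sS|]; last by exists s.
  by have [h|[t [tT h]]] := ridge_facet_cases sS; [exists s => _; left|exists t => _; right].
by exists tau.
Qed.

Variable tau : I -> I.
Hypothesis tauP : forall s, s \in S ->
  (tau s = s /\ facet X (X :\ s)) \/
  (tau s \in X :\: S /\ facet X (X :\: [set s; tau s])).

Let B := [set s in S | tau s != s].

Lemma matchedP s : s \in B ->
  [/\ s \in S, tau s \in X, tau s \notin S & facet X (X :\: [set s; tau s])].
Proof.
rewrite inE => /andP[sS ts]; have [[e]|[]] := tauP sS; first by rewrite e eqxx in ts.
by rewrite inE => /andP[-> ->].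
Qed.

Lemma apexP a : a \in S :\: B -> facet X (X :\ a).
Proof.
rewrite !inE => /andP[h aS]; rewrite aS negbK in h.
have [[_ //]|[]] := tauP aS.
by rewrite (eqP h) inE aS.
Qed.

Let sSX : S \subset X. Proof. exact: cface_sub (facet_face hS). Qed.

Lemma tau_inj : {in B &, injective tau}.
Proof.
move=> s s' /matchedP[sS tX tS hs] /matchedP[sS' _ _ hs'] e.
apply: (@cofacet_pair_disjoint (tau s)) => //; try exact: (subsetP sSX).
- by apply: contraNneq tS => ->.
- by apply: contraNneq tS => ->.
- by rewrite setUC.
- by rewrite setUC e.
Qed.

Lemma facet_form_at F : facet X F -> exists l,
  [/\ forall i, i \in X -> 0 <= ev l (v i),
      forall i, i \in X -> i \in F -> ev l (v i) = 0 &
      forall i, i \in X -> i \notin F -> 0 < ev l (v i)].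
Proof.
move=> hF; have [l [l0 lF lX]] := cface_form (facet_face hF).
by exists l; split=> // i _; exact: lF.
Qed.

(* The points of the simplex facet [S] together with [t0] form an affine basis;
   the facets met so far determine the signs of the coordinates of [t] in it. *)
Lemma coordinates t0 t : t0 \in X :\: S -> t \in X :\: S -> t != t0 ->
  exists c0 c, [/\ v t = c0 *: v t0 + \sum_(s in B) c s *: v s, 0 < c0,
    forall s, s \in B -> tau s != t0 -> tau s != t -> c s = 0,
    forall s, s \in B -> tau s = t0 -> c s < 0 &
    forall s, s \in B -> tau s = t -> 0 < c s].
Proof.
move=> /setDP[t0X t0S] /setDP[tX tS] tt0.
have [l [l0 lS lX]] := facet_form_at hS.
have sY : t0 |: S \subset X by rewrite subUset sub1set t0X.
have lS' j : j \in S -> ev l (v j) = 0 by move=> jS; rewrite lS // (subsetP sSX).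
have rY : (rk S < rk (t0 |: S))%N.
  apply: (rk_lt (subsetUr _ _) lS' (setU11 _ _)).
  by rewrite gt_eqF // lX.
have /eqP eY : span_of (t0 |: S) == span_of X.
  rewrite eqEdim span_mono //=; have [_ rS] := hS.
  by rewrite -/(rk X) -rS.
have := mem_span tX; rewrite -eY => /span_comb[c].
rewrite big_setU1 //= => ec.
have comb m : ev m (v t) = c t0 * ev m (v t0) + \sum_(s in S) c s * ev m (v s).
  by rewrite ec !evE ev_sum; congr (_ + _); apply: eq_bigr => s _; rewrite evZ.
have comb1 m s : s \in S -> (forall i, i \in S :\ s -> ev m (v i) = 0) ->
    ev m (v t) = c t0 * ev m (v t0) + c s * ev m (v s).
  move=> sS h; rewrite comb (bigD1 s) //= big1 ?addr0 // => i /andP[iS is_].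
  by rewrite h ?mulr0 // !inE is_.
have mS m s : (forall i, i \in X -> i \in X :\: [set s; tau s] -> ev m (v i) = 0) ->
    s \in B -> forall i, i \in S :\ s -> ev m (v i) = 0.
  move=> h /matchedP[_ _ tS' _] i /setD1P[is_ iS].
  have iX := subsetP sSX _ iS; apply: h => //.
  by rewrite !inE iX (negPf is_) /= andbT; apply: contraNneq tS' => <-.
exists (c t0), c; split.
- rewrite ec; congr (_ + _); rewrite [LHS](bigID (mem B)) /= [X in _ + X]big1 ?addr0.
    by apply: eq_bigl => i; rewrite !inE; case: (i \in S).
  move=> a /andP[aS aB]; have aSB : a \in S :\: B by rewrite inE aB.
  have aX := subsetP sSX _ aS.
  (* The facet [X :\ a] contains [t0], [t] and [S :\ a], so its form isolates the coefficient of [a]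
     and forces it to be 0. *)
  have [m [m0 mF mX]] := facet_form_at (apexP aSB).
  have ma i : i \in S :\ a -> ev m (v i) = 0.
    by move=> /setD1P[ia iS]; have iX := subsetP sSX _ iS; rewrite mF // !inE ia.
  have hn u : u \in X -> u \notin S -> ev m (v u) = 0.
    by move=> uX uS; rewrite mF // !inE uX andbT; apply: contraNneq uS => ->.
  have := comb1 m a aS ma; rewrite (hn t) // (hn t0) // mulr0 add0r => /esym/eqP.
  by rewrite mulf_eq0 [X in _ || X]gt_eqF ?orbF => [/eqP ->|]; rewrite ?scale0r // mX // !inE eqxx.
(* The form of [S] is positive at both [t] and [t0] and ignores the other terms. *)
- have := comb l; rewrite big1 ?addr0 => [e|s sS]; last by rewrite lS' // mulr0.
  have lt := lX _ tX tS; have lt0 := lX _ t0X t0S.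
  by move: lt; rewrite e pmulr_lgt0.
- move=> s sB st0 st; have [sS tauX tauS hs] := matchedP sB.
  have [m [m0 mF mX]] := facet_form_at hs; have sX := subsetP sSX _ sS.
  have hn u : u \in X -> u \notin S -> tau s != u -> ev m (v u) = 0.
    move=> uX uS su; rewrite mF // !inE uX andbT (eq_sym u (tau s)) negb_or su andbT.
    by apply: contraNneq uS => ->.
  have := comb1 m s sS (mS m s mF sB); rewrite (hn t) // (hn t0) // mulr0 add0r => /esym/eqP.
  by rewrite mulf_eq0 [X in _ || X]gt_eqF ?orbF => [/eqP ->|] //; rewrite mX // !inE eqxx.
(* The facet missing [s] and [t0] contains [t], so the contributions of [t0] and [s] to its form
   cancel. *)
- move=> s sB st; have [sS tauX tauS hs] := matchedP sB.
  have [m [m0 mF mX]] := facet_form_at hs; have sX := subsetP sSX _ sS.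
  have := comb1 m s sS (mS m s mF sB); rewrite mF //; last first.
    rewrite !inE tX andbT negb_or st tt0 andbT.
    by apply: contraNneq tS => ->.
  have m1 : 0 < ev m (v t0) by rewrite mX // -st !inE eqxx orbT.
  have m2 : 0 < ev m (v s) by rewrite mX // !inE eqxx.
  have c0 : 0 < c t0.
    have := comb l; rewrite big1 ?addr0 => [e|i iS]; last by rewrite lS' // mulr0.
    by have := lX _ tX tS; rewrite e pmulr_lgt0 // lX.
  have := mulr_gt0 c0 m1 => h /eqP; rewrite eq_sym addr_eq0 => /eqP e.
  by rewrite -(pmulr_llt0 _ m2); rewrite e in h; rewrite oppr_gt0 in h.
- move=> s sB st; have [sS tauX tauS hs] := matchedP sB.
  have [m [m0 mF mX]] := facet_form_at hs; have sX := subsetP sSX _ sS.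
  have := comb1 m s sS (mS m s mF sB); rewrite (mF t0) ?mulr0 ?add0r //; last first.
    rewrite !inE t0X andbT negb_or st (eq_sym t0 t) tt0 andbT.
    by apply: contraNneq t0S => ->.
  have m1 : 0 < ev m (v t) by rewrite mX // -st !inE eqxx orbT.
  have m2 : 0 < ev m (v s) by rewrite mX // !inE eqxx.
  by move=> e; rewrite e pmulr_lgt0 in m1.
Qed.

(** If [t0] were unmatched, no coefficient in [coordinates] would be negative, and another vertex
    [t] outside [S] would be a nonnegative combination of other vertices with positive weight on
    [t0], so not exposed. *)
Lemma tau_onto : tau @: B = X :\: S.
Proof.
apply/eqP; rewrite eqEsubset; apply/andP; split.
  by apply/subsetP => _ /imsetP[s /matchedP[_ tX tS _] ->]; rewrite inE tX tS.
apply/subsetP => t0 t0T; apply/negPn/negP => h.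
have [t tT tt0] : exists2 t, t \in X :\: S & t != t0.
  have : (0 < #|(X :\: S) :\ t0|)%N.
    rewrite lt0n; apply/eqP => h0.
    by have := cXS; rewrite (cardsD1 t0) t0T h0 => e; move: k4; rewrite -e.
  by case/card_gt0P => t /setD1P[? ?]; exists t.
have [c0 [c [et c00 cz _ cp]]] := coordinates t0T tT tt0.
have /setDP[tX _] := tT; have /setDP[t0X _] := t0T.
have [l [l0 lt lX]] := cface_form (hX tX).
have : 0 < ev l (v t).
  rewrite et !evE ev_sum ltr_wpDr //.
    apply: sumr_ge0 => s sB; rewrite evZ; have [sS _ _ _] := matchedP sB.
    rewrite mulr_ge0 // ?l0 ?(subsetP sSX) //.
    have [st|st] := eqVneq (tau s) t; first by rewrite ltW // cp.
    by rewrite cz //; apply: contraNneq h => <-; exact: imset_f.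
  by rewrite mulr_gt0 // lX // inE eq_sym.
by rewrite lt ?set11 // ltxx.
Qed.

(** In the coordinates of [tau s'] relative to [tau s], injectivity of [tau] leaves only the
    coefficients at [s], negative, and at [s'], positive; the negative term changes sides. *)
Lemma crossing s s' : s \in B -> s' \in B -> s != s' ->
  exists a b c : R, [/\ 0 < a, 0 < b, 0 < c &
    v (tau s') + a *: v s = b *: v (tau s) + c *: v s'].
Proof.
move=> sB s'B ss'; have tt : tau s' != tau s.
  by apply: contra ss' => /eqP/tau_inj e; rewrite e.
have tT u : u \in B -> tau u \in X :\: S by move=> uB; rewrite -tau_onto imset_f.
have [c0 [c [et c00 cz cn cp]]] := coordinates (tT _ sB) (tT _ s'B) tt.
exists (- c s), c0, (c s'); split=> //; [by rewrite oppr_gt0 cn|by rewrite cp|].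
rewrite et (bigD1 s) //= (bigD1 s') /=; last by rewrite s'B eq_sym.
rewrite big1 => [|i /andP[/andP[iB i1] i2]].
  by rewrite addr0 scaleNr [c s *: _ + _]addrC addrA addrK.
by rewrite cz ?scale0r //; [apply: contra i1|apply: contra i2] => /eqP/tau_inj ->.
Qed.

(** The second base, with the apexes. It is found as a facet through [tau s1] avoiding [s1]. *)
Lemma opposite_facet : cface X (X :\: B).
Proof.
have [s1 s1B] : exists s1, s1 \in B.
  apply/set0Pn; apply/eqP => B0.
  by have := cXS; rewrite -tau_onto B0 imset0 cards0 => e; move: k4; rewrite -e.
have [s1S t1X t1S hs1] := matchedP s1B; have s1X := subsetP sSX _ s1S.
have [|G [hG s1G Gs1]] := facet_sep (hX t1X) s1X.
  by rewrite inE; apply: contraNneq t1S => <-.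
rewrite sub1set in s1G.
have sGX := cface_sub (facet_face hG).
suff <- : G = X :\: B by exact: facet_face.
have hB s' : s' \in B -> s' \notin G.
  move=> s'B; have [<- //|ss'] := eqVneq s1 s'.
  (* The form of [G] would vanish at [tau s1] and [s'], hence by positivity at [s1]. *)
  apply/negP => s'G; have [a [b [c [a0 b0 c0 e]]]] := crossing s1B s'B ss'.
  have [l [l0 lG lX]] := cface_form (facet_face hG).
  have [_ t'X _ _] := matchedP s'B.
  have : ev l (v (tau s') + a *: v s1) = 0 by rewrite e !evE !lG // !mulr0 addr0.
  rewrite !evE; have := l0 _ t'X; have := mulr_gt0 a0 (lX _ s1X Gs1); lra.
apply/eqP; rewrite eqEsubset; apply/andP; split.
  by apply/subsetP => i iG; rewrite inE (subsetP sGX) // andbT; apply: contraL iG; exact: hB.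
(* A missing [i] would put [G] inside a known facet, hence make it equal to it; but each of these
   contains [s1] or omits [tau s1]. *)
apply/subsetP => i /setDP[iX iB]; apply/negPn/negP => iG.
case: (boolP (i \in S)) => iS.
  have hi : facet X (X :\ i) by apply: apexP; rewrite inE iB.
  have e : G = X :\ i.
    apply: (facet_subset_eq hG (facet_face hi)).
      by apply/eqP => /setP/(_ i); rewrite !inE eqxx iX.
    by rewrite subsetD1 sGX.
  by move: Gs1; rewrite e !inE s1X andbT negbK => /eqP e1; rewrite -e1 s1B in iB.
have : i \in tau @: B by rewrite tau_onto inE iS.
case/imsetP => s sB ei; have [sS _ _ hs] := matchedP sB; have sX := subsetP sSX _ sS.
have e : G = X :\: [set s; tau s].
  apply: (facet_subset_eq hG (facet_face hs)).
    by apply/eqP => /setP/(_ s); rewrite !inE eqxx sX.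
  apply/subsetP => j jG; rewrite !inE (subsetP sGX) // andbT negb_or -ei.
  by apply/andP; split; apply: contraTneq jG => ->; rewrite // hB.
move: Gs1; rewrite e !inE s1X andbT negbK => /orP[/eqP es|/eqP es].
  by move: iG; rewrite ei -es s1G.
by have [_ _] := matchedP sB; rewrite -es s1S.
Qed.

End FewEdges.

(** The data handed to the geometric part: [A] collects the apexes, [B] and [tau @: B] are the bases
    of the prism. *)
Theorem few_edges_prism X d k : convex_position X -> rk X = d.+1 ->
  #|X| = (d + k)%N -> (4 <= k)%N -> (k <= d)%N ->
  (#|edges X| + 'C(d.+1 - k, 2) < d * d + (k - 3))%N ->
  exists (A B : {set I}) (tau : I -> I),
    [/\ [/\ #|A| = (d - k)%N, #|B| = k & {in B &, injective tau}],
        [/\ [disjoint A & B], [disjoint A :|: B & tau @: B] &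
            X = A :|: B :|: tau @: B],
        [/\ cface X (A :|: B), cface X (A :|: tau @: B),
            forall a, a \in A -> cface X (X :\ a) &
            forall s, s \in B -> cface X (X :\: [set s; tau s])] &
        forall s s', s \in B -> s' \in B -> s != s' ->
          exists a b c : R, [/\ 0 < a, 0 < b, 0 < c &
            v (tau s') + a *: v s = b *: v (tau s) + c *: v s']].
Proof.
move=> hX rX cX k4 kd few.
have [S [hS cXS]] := simplex_facet_exists hX rX cX k4 kd few.
have [tau tauP] := matching_exists hX rX cX k4 kd few hS cXS.
pose B := [set s in S | tau s != s].
have sBS : B \subset S by apply/subsetP => s; rewrite inE => /andP[].
have onto : tau @: B = X :\: S := tau_onto hX k4 hS cXS tauP.
have tinj := tau_inj hX rX cX k4 kd few hS tauP.
have sSX := cface_sub (facet_face hS).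
have eAB : S :\: B :|: B = S by rewrite setUC -{1}(setIidPr sBS) setID.
have cB : #|B| = k by rewrite -(card_in_imset tinj) onto.
have cS := card_simplex_facet hX rX cX k4 kd few hS cXS.
exists (S :\: B), B, tau; split.
- by split=> //; have := cardsID B S; rewrite (setIidPr sBS) cB cS => <-; rewrite addKn.
- rewrite eAB onto; split.
  + by rewrite -setI_eq0; apply/eqP/setP => i; rewrite !inE; case: (i \in S); case: (tau i == i).
  + by rewrite -setI_eq0; apply/eqP/setP => i; rewrite !inE; case: (i \in S).
  + by rewrite -{1}(setIidPr sSX) setID.
- rewrite eAB onto; split; first exact: facet_face.
  + suff -> : S :\: B :|: (X :\: S) = X :\: B.
      exact: (opposite_facet hX rX cX k4 kd few hS cXS tauP).
    apply/setP => i; rewrite !inE; case: (boolP (i \in S)) => //= iS.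
    by rewrite (subsetP sSX) // !andbT orbF.
  + by move=> a aA; apply: facet_face; apply: apexP aA.
  + by move=> s sB; apply: facet_face; have [] := matchedP tauP sB.
- by move=> s s' sB s'B ss'; apply: (crossing hX rX cX k4 kd few hS cXS tauP).
Qed.

End Configuration.

(** Induction on the number of generators. If the form [l] obtained for [X :\ i] is negative at
    [v i], everything is projected along [v i] onto the kernel of [l], which sends [v i] to 0. *)
Lemma farkas (R : realFieldType) (E : vectType R) (I : finType) (v : I -> E)
    (X : {set I}) (b : E) :
  (exists2 c : I -> R, forall i, 0 <= c i & b = \sum_(i in X) c i *: v i) \/
  exists2 l : 'Hom(E, R^o), forall i, i \in X -> 0 <= ev l (v i) & ev l b < 0.
Proof.
have [n] := ubnP #|X|; elim: n v X b => // n IH v X b ltX.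
have [->|/set0Pn[i iX]] := eqVneq X set0.
  have [->|b0] := eqVneq b 0.
    by left; exists (fun=> 0) => // ; rewrite big_set0.
  have [l [_ lb]] : exists l, (forall u, u \in 0%VS -> ev l u = 0) /\ ev l b != 0.
    by apply: separating_form; rewrite memv0.
  have [l1|l1] := ltP (ev l b) 0; right; first by exists l => // j; rewrite inE.
  by exists (- l) => [j|]; rewrite ?inE // ev_oppf oppr_lt0 lt_neqAle eq_sym lb.
have ltXi : (#|X :\ i| < n)%N by move: ltX; rewrite (cardsD1 i X) iX.
have [[c c0 eb]|[l l0 lb]] := IH v (X :\ i) b ltXi.
  left; exists (fun j => if j == i then 0 else c j) => [j|]; first by case: eqP.
  rewrite (big_setD1 i) //= eqxx scale0r add0r eb; apply: eq_bigr => j.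
  by rewrite !inE => /andP[/negPf ->].
have [li|li] := leP 0 (ev l (v i)).
  right; exists l => // j jX; have [-> //|ji] := eqVneq j i.
  by apply: l0; rewrite !inE ji.
pose r y := ev l y / ev l (v i); pose pi y := y - r y *: v i.
have [[c c0 eb]|[m m0 mb]] := IH (pi \o v) (X :\ i) (pi b) ltXi.
  (* The coefficient of [v i] is nonnegative because [l] is negative at [b] and [v i] and
     nonnegative at the other generators. *)
  pose a := r b - \sum_(j in X :\ i) c j * r (v j).
  left; exists (fun j => if j == i then a else c j) => [j|].
    case: eqP => // _; rewrite /a subr_ge0; apply: (@le_trans _ _ 0).
      apply: sumr_le0 => k kX; rewrite mulr_ge0_le0 // /r mulr_ge0_le0 ?l0 //.
      by rewrite invr_le0 ltW.
    by rewrite /r mulr_le0 ?invr_le0 ?ltW.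
  rewrite (big_setD1 i) //= eqxx.
  rewrite [X in _ + X](eq_bigr (fun j => c j *: v j)) => [|j]; last first.
    by rewrite !inE => /andP[/negPf ->].
  rewrite -[LHS](subrK (r b *: v i)) -/(pi b) eb /a scalerBl [LHS]addrC -[RHS]addrA.
  congr (_ + _); rewrite scaler_suml [RHS]addrC -sumrB.
  by apply: eq_bigr => j _; rewrite /= scalerBr scalerA.
(* This is [m] composed with the projection [pi]. *)
right; exists (m - (ev m (v i) / ev l (v i)) *: l) => [j jX|]; last first.
  by move: mb; rewrite /pi /r !evE; congr (_ < _); ring.
have [->|ji] := eqVneq j i; first by rewrite !evE divfK ?subrr // lt_eqF.
have := m0 j; rewrite !inE ji jX => /(_ isT); rewrite /= /pi /r !evE.
by congr (_ <= _); ring.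
Qed.

Lemma cface_bigcap (R : realFieldType) (E : vectType R) (I : finType) (v : I -> E)
    (K : finType) (Q : pred K) (F : K -> {set I}) :
  (forall i, Q i -> cface v setT (F i)) -> cface v setT (\bigcap_(i | Q i) F i).
Proof.
by move=> h; elim/big_ind: _ => //; [exact: cfacexx|move=> G H; exact: cfaceI].
Qed.

Lemma cface_reindex (R : realFieldType) (E : vectType R) (I J : finType) (v : I -> E)
    (g : J -> I) (X F : {set I}) :
  (forall j, g j \in X) -> cface v X F -> cface (v \o g) setT (g @^-1: F).
Proof.
move=> gX [l [l0 ->]]; exists l; split=> [j _|]; first exact: l0.
by apply/setP => j; rewrite !inE gX.
Qed.

(** * The face lattice of a prism *)

Section PrismFaces.
Variables (R : realFieldType) (E : vectType R) (K : finType) (w : K * bool -> E).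

Hypothesis bottom : cface w setT [set q | ~~ q.2].
Hypothesis top : cface w setT [set q | q.2].
Hypothesis side : forall i, cface w setT [set q | q.1 != i].
Hypothesis cross : forall i j, i != j -> exists a b c : R, [/\ 0 < a, 0 < b, 0 < c &
  w (j, true) + a *: w (i, false) = b *: w (i, true) + c *: w (j, false)].

(** Every subset of a base occurs because the bases are simplices; the third case is a prism over a
    face of the base. *)
Definition prism_face (G : {set K * bool}) :=
  [\/ G \subset [set q | ~~ q.2], G \subset [set q | q.2] |
      forall i, ((i, false) \in G) = ((i, true) \in G)].

Lemma prism_faces G : cface w setT G <-> prism_face G.
Proof.
(* [G] is [Y] cut by the sides of the vertical edges disjoint from [G]; by the last condition, a
   label in [Y] but not in [G] lies on such an edge. *)
have cap Y : cface w setT Y -> G \subset Y ->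
    (forall i b, (i, b) \in Y -> (i, b) \notin G -> (i, ~~ b) \notin G) -> cface w setT G.
  move=> hY sGY hG; pose Q i := [forall b, (i, b) \notin G].
  suff -> : G = Y :&: \bigcap_(i | Q i) [set q | q.1 != i].
    by apply: cfaceI => //; apply: cface_bigcap.
  apply/setP => -[i b]; rewrite inE; apply/idP/andP => [qG|[qY /bigcapP h]].
    split; first exact: (subsetP sGY).
    by apply/bigcapP => j /forallP/(_ b) jG; rewrite inE /=; apply: contraTneq qG => ->.
  apply: contraT => qG; suff /h : Q i by rewrite inE eqxx.
  apply/forallP => b'; have [->//|bb] := eqVneq b' b.
  by rewrite (_ : b' = ~~ b) ?hG //; move: bb; clear; case: b' b => [] [].
split=> [[l [l0 eG]]|[sG|sG|eG]].
(* A nonnegative form vanishing at the ends of one diagonal vanishes at the ends of the other. *)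
- have sw i j : i != j -> (i, false) \in G -> (j, true) \in G ->
      (i, true) \in G /\ (j, false) \in G.
    rewrite eG !inE /= => ij /eqP li /eqP lj; have [a [b [c [a0 b0 c0 e]]]] := cross ij.
    have : ev l (b *: w (i, true) + c *: w (j, false)) = 0.
      by rewrite -e !evE li lj mulr0 addr0.
    rewrite !evE => /eqP; rewrite paddr_eq0 ?mulr_ge0 ?l0 ?ltW //.
    by rewrite !mulf_eq0 (gt_eqF b0) (gt_eqF c0) => /andP[].
  case: (boolP (G \subset [set q | ~~ q.2])) => h0; first by constructor 1.
  case: (boolP (G \subset [set q | q.2])) => h1; first by constructor 2.
  (* One top and one bottom vertex in [G] suffice to transfer membership along every vertical
     edge. *)
  constructor 3; case/subsetPn: h0 => -[j bj] jG; rewrite inE negbK /= => ebj.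
  case/subsetPn: h1 => -[i bi] iG; rewrite inE /= => ebi.
  rewrite {}ebj {bj} in jG; rewrite (negPf ebi) {bi ebi} in iG.
  move=> m; apply/idP/idP => mG.
    by have [->//|mj] := eqVneq m j; have [] := sw m j mj mG jG.
  by have [->//|im] := eqVneq m i; have [] := sw i m; rewrite 1?eq_sym.
- apply: (cap _ bottom sG) => i [|]; rewrite inE //= => _ _.
  by apply/negP => /(subsetP sG); rewrite inE.
- apply: (cap _ top sG) => i [|]; rewrite inE //= => _ _.
  by apply/negP => /(subsetP sG); rewrite inE.
- by apply: (cap _ (cfacexx w setT) (subsetT _)) => i [|] _ /=; rewrite eG.
Qed.

End PrismFaces.

From mathcomp Require Import classical_sets functions cardinality reals.
From mathcomp Require Import finmap interval_inference convex.

Local Open Scope classical_set_scope.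
Local Open Scope ring_scope.

(** * Homogenized points and affine forms *)

Section Homogenization.
Variables (R : realType) (n : nat).
Local Notation E := (R^o * 'rV[R]_n)%type.
Implicit Types (x y : 'rV[R]_n) (l : 'Hom(E, R^o)).

Definition homog x : E := (1, x).

(** On [homog x] this is the slack of the inequality in the definition of [face]. *)
Definition affine_form (a : 'cV[R]_n) (b : R) (z : E) : R^o :=
  b * z.1 - (z.2 *m a) 0 0.

Fact affine_form_is_linear a b : linear (affine_form a b).
Proof.
move=> t u z; rewrite /affine_form /= mulmxDl -scalemxAl !mxE /=.
have scaleE (r s : R) : r *: (s : R^o) = r * s by [].
by rewrite !scaleE; ring.
Qed.

HB.instance Definition _ a b :=
  GRing.isLinear.Build R E R^o _ (affine_form a b)
    (affine_form_is_linear a b).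

Lemma ev_affine_form a b x : ev (linfun (affine_form a b)) (homog x) = b - (x *m a) 0 0.
Proof. by rewrite /ev lfunE /= /affine_form /= mulr1. Qed.

Lemma ev_homog l : exists (a : 'cV[R]_n) (b : R), forall x, ev l (homog x) = b - (x *m a) 0 0.
Proof.
pose a : 'cV[R]_n := \col_(j < n) - ev l ((0, delta_mx 0 j) : E); exists a, (ev l ((1, 0) : E)); move=> x.
have -> : homog x = (1, 0) + \sum_j x 0 j *: ((0, (delta_mx 0 j : 'rV[R]_n)) : E).
  rewrite {1}/homog {1}(row_sum_delta x).
  have -> : \sum_j x 0 j *: ((0, (delta_mx 0 j : 'rV[R]_n)) : E) =
            (0, \sum_j x 0 j *: delta_mx 0 j).
    elim/big_rec2: _ => // j y z _ ->; congr pair => //=.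
    by rewrite addr0 scaler0.
  by congr pair; rewrite /= ?addr0 ?add0r.
rewrite evD ev_sum mxE -sumrN; congr (_ + _); apply: eq_bigr => j _.
by rewrite evZ mxE mulrN opprK.
Qed.

Definition conv_point (t : R) x y := (1 - t) *: x + t *: y.

Lemma homog_conv_point t x y : homog (conv_point t x y) = (1 - t) *: homog x + t *: homog y.
Proof.
have scaleE (r s : R) : r *: (s : R^o) = r * s by [].
by rewrite /homog /conv_point; congr pair; rewrite /= !scaleE !mulr1 subrK.
Qed.

Lemma convex_setP (A : set 'rV[R]_n) : @convex_set R 'rV[R]_n A <->
  forall t x y, 0 <= t -> t <= 1 -> A x -> A y -> A (conv_point t x y).
Proof.
split=> [h t x y t0 t1 Ax Ay|h x y t xA yA].
  have /set_mem := h y x (Itv01 t0 t1) (mem_set Ay) (mem_set Ax).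
  by rewrite /conv_point addrC.
apply/mem_set; have := h t%:num y x; rewrite /conv_point addrC.
by apply => //; exact: set_mem.
Qed.

End Homogenization.

(** * Convex hulls of indexed points and their faces *)

Section Hull.
Variables (R : realType) (n : nat) (I : finType) (p : I -> 'rV[R]_n).
Local Notation E := (R^o * 'rV[R]_n)%type.
Local Notation v := (fun i => homog (p i)).
Implicit Types (Y G : {set I}) (c : I -> R) (l : 'Hom(E, R^o)).

Definition hull Y : set 'rV[R]_n := conv_hull (p @` [set i | i \in Y]).

Lemma sum_homog Y c : \sum_(i in Y) c i *: homog (p i) =
  (\sum_(i in Y) c i : R^o, \sum_(i in Y) c i *: p i).
Proof.
elim/big_rec3: _ => // i x y z _ ->; congr pair => /=.
by congr (_ + _); rewrite -[LHS]/(c i * 1) mulr1.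
Qed.

Lemma sum_coef x Y c : homog x = \sum_(i in Y) c i *: homog (p i) -> \sum_(i in Y) c i = 1.
Proof. by rewrite sum_homog => -[-> _]. Qed.

Lemma homog_comb x Y c : \sum_(i in Y) c i = 1 -> x = \sum_(i in Y) c i *: p i ->
  homog x = \sum_(i in Y) c i *: homog (p i).
Proof. by rewrite sum_homog => -> ->. Qed.

(** The homogenized equation also records that the coefficients sum to 1. One point is split off and
    the others are rescaled. *)
Lemma convex_comb (A : set 'rV[R]_n) Y c x : @convex_set R 'rV[R]_n A ->
  (forall i, i \in Y -> A (p i)) -> (forall i, i \in Y -> 0 <= c i) ->
  homog x = \sum_(i in Y) c i *: homog (p i) -> A x.
Proof.
move=> /convex_setP cA; have [m] := ubnP #|Y|; elim: m Y c x => // m IH Y c x ltY AY c0 ex.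
have s1 := sum_coef ex.
have [Y0|/set0Pn[i iY]] := eqVneq Y finset.set0.
  by move: s1; rewrite Y0 big_set0 => /esym/eqP; rewrite oner_eq0.
have sY : \sum_(j in Y :\ i) c j = 1 - c i.
  by have := s1; rewrite (big_setD1 i) //= => <-; rewrite addrAC subrr add0r.
have c0' j : j \in Y :\ i -> 0 <= c j by move=> /setD1P[_ jY]; exact: c0.
have [ci|ci] := eqVneq (c i) 1.
  have z j : j \in Y :\ i -> c j = 0.
    move=> jY; move/eqP: sY; rewrite ci subrr psumr_eq0 // => /allP/(_ j).
    by rewrite mem_index_enum jY => /(_ isT)/eqP.
  have : homog x = homog (p i).
    rewrite ex (big_setD1 i) //= ci scale1r big1 ?addr0 // => j jY.
    by rewrite z // scale0r.
  by case=> ->; exact: AY.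
have d0 : 0 < 1 - c i.
  rewrite lt_neqAle eq_sym subr_eq0 eq_sym ci /= -sY; exact: sumr_ge0.
pose y := \sum_(j in Y :\ i) (c j / (1 - c i)) *: p j.
have hy : homog y = \sum_(j in Y :\ i) (c j / (1 - c i)) *: homog (p j).
  by apply: homog_comb => //; rewrite -mulr_suml sY divff // gt_eqF.
have Ay : A y.
  apply: (IH _ _ _ _ _ _ hy) => [|j /setD1P[_ jY]|j jY]; first 2 last.
  - by rewrite divr_ge0 ?c0' // ltW.
  - by move: ltY; rewrite (cardsD1 i) iY.
  - exact: AY.
have : A (conv_point (1 - c i) (p i) y).
  by apply: cA => //; [exact: ltW|have := c0 _ iY; lra|exact: AY].
suff [<-] : homog x = homog (conv_point (1 - c i) (p i) y) by [].
rewrite homog_conv_point hy ex (big_setD1 i) //= subKr scaler_sumr; congr (_ + _).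
by apply: eq_bigr => j _; rewrite scalerA mulrC divfK // gt_eqF.
Qed.

Lemma hullP Y x : hull Y x <->
  exists2 c, forall i, 0 <= c i & homog x = \sum_(i in Y) c i *: homog (p i).
Proof.
split=> [h|[c c0 ex]]; last first.
  move=> A [cA sA]; apply: (convex_comb cA _ _ ex) => // i iY.
  by apply: sA; exists i.
pose A x := exists2 c, forall i, 0 <= c i & homog x = \sum_(i in Y) c i *: homog (p i).
apply: (h A); split.
  apply/convex_setP => t y z t0 t1 [c c0 ey] [d d0 ez].
  exists (fun i => (1 - t) * c i + t * d i) => [i|].
    by rewrite addr_ge0 ?mulr_ge0 // subr_ge0.
  rewrite homog_conv_point ey ez !scaler_sumr -big_split /=; apply: eq_bigr => i _.
  by rewrite [RHS]scalerDl !scalerA.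
move=> _ [i /= iY <-]; exists (fun j => (j == i)%:R) => [j|]; first exact: ler0n.
rewrite (big_setD1 i) //= eqxx scale1r big1 ?addr0 // => j /setD1P[/negPf -> _].
by rewrite scale0r.
Qed.

Lemma hull_pt Y i : i \in Y -> hull Y (p i).
Proof. by move=> iY A [_]; apply; exists i. Qed.

Lemma hull_convex Y : @convex_set R 'rV[R]_n (hull Y).
Proof.
apply/convex_setP => t x y t0 t1 hx hy A [cA sA].
by move/convex_setP: (cA); apply=> //; [apply: hx|apply: hy].
Qed.

Lemma hull_sub Y (A : set 'rV[R]_n) : @convex_set R 'rV[R]_n A ->
  (forall i, i \in Y -> A (p i)) -> hull Y `<=` A.
Proof. by move=> cA sA x; apply; split=> // _ [i iY <-]; exact: sA. Qed.

Lemma hullS Y G : G \subset Y -> hull G `<=` hull Y.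
Proof.
move=> /fintype.subsetP sGY; apply: hull_sub; first exact: hull_convex.
by move=> i /sGY; exact: hull_pt.
Qed.

Lemma hull_polytope Y : is_polytope (hull Y).
Proof.
exists [seq p i | i <- enum Y]; congr conv_hull; apply/seteqP; split=> x /=.
  by move=> [i iY <-]; apply: map_f; rewrite mem_enum.
by case/mapP => i; rewrite mem_enum => iY ->; exists i.
Qed.

(** Nonnegative terms with sum 0 all vanish, so a point of the face puts no weight where [l] is
    positive. *)
Lemma hull_zero_set Y l : (forall i, i \in Y -> 0 <= ev l (homog (p i))) ->
  [set x | hull Y x /\ ev l (homog x) = 0] =
  hull [set i in Y | ev l (homog (p i)) == 0]%SET.
Proof.
move=> l0; apply/seteqP; split=> x /=.
  case=> /hullP[c c0 ex] lx; apply/hullP; exists c => //.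
  have z i : i \in Y -> ev l (homog (p i)) != 0 -> c i = 0.
    move=> iY li; have : \sum_(i in Y) c i * ev l (homog (p i)) = ev l (homog x).
      by rewrite ex ev_sum; apply: eq_bigr => j _; rewrite evZ.
    move/eqP; rewrite lx.
    rewrite psumr_eq0 => [/allP/(_ i)|j jY]; last by rewrite mulr_ge0 ?l0.
    by rewrite mem_index_enum iY mulf_eq0 (negPf li) orbF => /(_ isT)/eqP.
  rewrite ex [LHS](bigID (fun i => ev l (homog (p i)) == 0)) /= [X in _ + X]big1 ?addr0.
    by apply: eq_bigl => i; rewrite !inE.
  by move=> i /andP[iY li]; rewrite z // scale0r.
move=> hx; split; first by apply: hullS hx; apply/fintype.subsetP => i; rewrite inE => /andP[].
have /hullP[c c0 ->] := hx; rewrite ev_sum big1 // => i.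
by rewrite inE evZ => /andP[_ /eqP ->]; rewrite mulr0.
Qed.

Lemma hull_ge0 Y l : (forall i, i \in Y -> 0 <= ev l (homog (p i))) ->
  forall x, hull Y x -> 0 <= ev l (homog x).
Proof.
move=> l0 x /hullP[c c0 ->]; rewrite ev_sum; apply: sumr_ge0 => i iY.
by rewrite evZ mulr_ge0 ?l0.
Qed.

Lemma faceP Y F : face (hull Y) F <-> exists2 G, cface v Y G & F = hull G.
Proof.
split=> [[a [b [hb ->]]]|[G [l [l0 ->]] ->]].
  pose l := linfun (affine_form a b).
  have l0 i : i \in Y -> 0 <= ev l (homog (p i)).
    by move=> iY; rewrite ev_affine_form subr_ge0 hb //; exact: hull_pt.
  exists [set i in Y | ev l (homog (p i)) == 0]%SET; first by exists l.
  rewrite -hull_zero_set //; apply/seteqP; split=> x [hx e]; split=> //.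
    by rewrite ev_affine_form e subrr.
  by move/eqP: e; rewrite ev_affine_form subr_eq0 => /eqP.
have [a [b e]] := ev_homog l; exists a, b; split=> [x hx|].
  by have := hull_ge0 l0 hx; rewrite e subr_ge0.
rewrite -hull_zero_set //; apply/seteqP; split=> x [hx h]; split=> //.
  by move/eqP: h; rewrite e subr_eq0 => /eqP.
by rewrite e h subrr.
Qed.

Lemma cface_hull Y G i : cface v Y G -> i \in Y -> hull G (p i) -> i \in G.
Proof.
move=> [l [l0 ->]] iY /hullP[c c0 e]; rewrite inE iY; apply/eqP.
rewrite e ev_sum big1 // => j; rewrite inE => /andP[_ /eqP lj].
by rewrite evZ lj mulr0.
Qed.

Lemma hull_inj Y G H : cface v Y G -> cface v Y H -> hull G = hull H -> G = H.
Proof.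
move=> hG hH e; apply/setP => i; apply/idP/idP => iG.
  apply: (cface_hull hH); first exact: (fintype.subsetP (cface_sub hG)).
  by rewrite -e; exact: hull_pt.
apply: (cface_hull hG); first exact: (fintype.subsetP (cface_sub hH)).
by rewrite e; exact: hull_pt.
Qed.

Lemma hull_setU1 Y a : conv_hull (hull Y `|` [set p a]) = hull (a |: Y)%SET.
Proof.
apply/seteqP; split=> x.
  move=> h; apply: h; split; first exact: hull_convex.
  move=> y [|->]; last by apply: hull_pt; exact: setU11.
  by apply: hullS; exact: finset.subsetUr.
move=> h A [cA sA]; apply: h; split=> // _ [i /= iaY <-].
case/setU1P: iaY => [->|iY]; apply: sA; [by right|left; exact: hull_pt].
Qed.

(** Affine sets are closed only under lines through two points, so an affine combination is reached
    from two convex ones. *)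
Lemma aff_hull_hull Y : aff_hull (hull Y) = [set x | homog x \in span_of v Y].
Proof.
apply/seteqP; split=> x /=.
  move=> h; apply: (h [set x | homog x \in span_of v Y]); split.
    move=> y z t /= hy hz; rewrite -/(conv_point t y z) homog_conv_point.
    by rewrite memvD ?memvZ.
  move=> y /hullP[c c0 /= ->]; apply: memv_suml => i iY.
  by rewrite memvZ //; exact: (@mem_span _ _ _ v).
move=> /span_comb[c ex] A [aA sA].
have s1 := sum_coef ex.
have Y0 : (0 < #|Y|)%N.
  rewrite card_gt0; apply/eqP => Y0; move: s1; rewrite Y0 big_set0 => /esym/eqP.
  by rewrite oner_eq0.
pose m : R := #|Y|%:R; have m0 : 0 < m by rewrite ltr0n.
have sm : \sum_(i in Y) m^-1 = 1 by rewrite sumr_const -[_ *+ _]mulr_natr mulVf // gt_eqF.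
pose g := \sum_(i in Y) m^-1 *: p i.
have hg : homog g = \sum_(i in Y) m^-1 *: homog (p i) by exact: homog_comb.
(* [x] lies on the line through the centroid [g] and a point [y] of the hull. *)
pose s : R := \sum_(i in Y) `|c i|; pose N : R := 1 + m * s.
have N0 : 0 < N by rewrite ltr_pwDl // mulr_ge0 ?sumr_ge0 // ltW.
(* As [N - 1 = m * s] dominates [m * |c i|], each [d i] is nonnegative. *)
pose d i := (1 - N^-1) * m^-1 + N^-1 * c i.
have d0 i : i \in Y -> 0 <= d i.
  move=> iY; rewrite -(pmulr_rge0 _ (mulr_gt0 N0 m0)).
  have -> : N * m * d i = (N - 1) + m * c i.
    by rewrite /d; field; rewrite !gt_eqF.
  have h1 : `|c i| <= s by rewrite /s (big_setD1 i) //= lerDl sumr_ge0.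
  have h2 := ler_norm (- c i); rewrite normrN in h2.
  have -> : N - 1 + m * c i = m * (s + c i) by rewrite /N; ring.
  by apply: mulr_ge0; [exact: ltW|lra].
pose y := conv_point N^-1 g x.
have hy : homog y = \sum_(i in Y) d i *: homog (p i).
  rewrite homog_conv_point hg ex !scaler_sumr -big_split /=; apply: eq_bigr => i _.
  by rewrite /d [RHS]scalerDl !scalerA.
have Ay : A y by apply: sA; apply: (convex_comb (@hull_convex Y) _ d0 hy) => i; exact: hull_pt.
have Ag : A g.
  apply: sA; apply: (convex_comb (@hull_convex Y) _ _ hg) => i; first exact: hull_pt.
  by rewrite invr_ge0 ltW.
have -> : x = conv_point N g y.
  rewrite /y /conv_point scalerDr !scalerA divff ?gt_eqF // scale1r addrA -scalerDl.
  have -> : 1 - N + N * (1 - N^-1) = 0 by field; rewrite gt_eqF.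
  by rewrite scale0r add0r.
exact: aA.
Qed.

End Hull.

(** * Dimension, face numbers and irredundant vertex sets *)

Section Dimension.
Variables (R : realType) (n : nat) (I : finType) (p : I -> 'rV[R]_n).
Local Notation E := (R^o * 'rV[R]_n)%type.
Local Notation v := (fun i => homog (p i)).
Implicit Types (Y G : {set I}) (l : 'Hom(E, R^o)).

Definition embed (u : 'rV[R]_n) : E := (0, u).

Fact embed_is_linear : linear embed.
Proof. by move=> a x y; rewrite /embed; congr pair; rewrite /= scaler0 addr0. Qed.

HB.instance Definition _ :=
  GRing.isLinear.Build R 'rV[R]_n E _ embed embed_is_linear.

Lemma homogD (x u : 'rV[R]_n) : homog (x + u) = homog x + embed u.
Proof. by rewrite /homog /embed; congr pair; rewrite /= addr0. Qed.

(** The span is the direction space at height 0 plus one line through a vector of height 1. *)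
Lemma rk_of_direction Y x0 (U : {vspace 'rV[R]_n}) :
  [set x | homog x \in span_of v Y] = [set x0 + u | u in [set u | u \in U]] ->
  rk v Y = (\dim U).+1.
Proof.
move=> e; have mem x : homog x \in span_of v Y <-> exists2 u, u \in U & x0 + u = x.
  by have := congr1 (fun A : set _ => A x) e => /= ->.
have x0W : homog x0 \in span_of v Y by apply/mem; exists 0; rewrite ?mem0v ?addr0.
pose f : 'Hom('rV[R]_n, E) := linfun embed.
have eW : span_of v Y = (<[homog x0]> + f @: U)%VS.
  apply: subv_anti; apply/andP; split.
    apply: span_sub => i iY; have /mem[u uU <-] := @mem_span _ _ _ v _ _ iY.
    rewrite homogD memv_add ?memv_line //.
    have -> : embed u = f u by rewrite lfunE.
    exact: memv_img.
  rewrite subv_add -memvE x0W; apply/subvP => _ /memv_imgP[u uU ->].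
  have -> : f u = homog (x0 + u) - homog x0 by rewrite lfunE homogD addrC addKr.
  by rewrite memvB //; apply/mem; exists u.
rewrite /rk eW dimv_disjoint_sum.
  rewrite dim_vline limg_dim_eq ?add1n //.
    by have -> : homog x0 != 0 :> E by rewrite xpair_eqE oner_eq0.
  apply/eqP; rewrite -subv0; apply/subvP => u /memv_capP[_].
  by rewrite memv_ker lfunE /= xpair_eqE memv0 => /andP[].
apply/eqP; rewrite -subv0; apply/subvP => _ /memv_capP[/vlineP[a ->]].
case/memv_imgP => u _; rewrite lfunE /= => -[/eqP + _].
by rewrite -[_ *: _]/(a * 1) mulr1 => /eqP ->; rewrite scale0r mem0v.
Qed.

Lemma has_dim_hull Y e : has_dim (hull p Y) e <-> rk v Y = e.+1.
Proof.
split=> [[x0 [U [<- h]]]|rY].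
  by apply: (@rk_of_direction _ x0); rewrite -aff_hull_hull.
have [i iY] : exists i, i \in Y.
  by apply/set0Pn; apply: contra_eq_neq rY => ->; rewrite rk0.
have iW : homog (p i) \in span_of v Y := @mem_span _ _ _ v _ _ iY.
pose U := (linfun embed @^-1: span_of v Y)%VS.
have h : [set x | homog x \in span_of v Y] = [set p i + u | u in [set u | u \in U]].
  apply/seteqP; split=> x /=.
    move=> hx; exists (x - p i); last by rewrite addrC subrK.
    rewrite /= -memv_preim lfunE /=.
    have -> : embed (x - p i) = homog x - homog (p i).
      by apply/esym; rewrite -{1}[x](subrK (p i)) (addrC _ (p i)) homogD addrC addKr.
    exact: memvB.
  by move=> [u + <-]; rewrite /= -memv_preim lfunE /= homogD => uU; exact: memvD.
exists (p i), U; split; last by rewrite aff_hull_hull.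
by have := rk_of_direction h; rewrite rY => -[].
Qed.

Lemma f_number_hull Y e : f_number e (hull p Y) =
  #|[set G : {set I} | `[< cface v Y G >] && (rk v G == e.+1)]%SET|.
Proof.
set D := [set G : {set I} | _]%SET.
have -> : #|D| = #|` [fset hull p G | G in D]%fset|.
  rewrite card_in_imfset ?cardE // => G H; rewrite !inE.
  by move=> /andP[/asboolP hG _] /andP[/asboolP hH _]; exact: (hull_inj hG hH).
rewrite /f_number; congr (#|` _ |); rewrite -[RHS]set_fsetK; congr fset_set.
apply/seteqP; split=> F /=.
  case=> /faceP[G hG ->] /has_dim_hull rG; apply/imfsetP; exists G => //=.
  by rewrite inE rG eqxx andbT; apply/asboolP.
case/imfsetP => G /=; rewrite inE => /andP[/asboolP hG /eqP rG] ->.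
by split; [apply/faceP; exists G|apply/has_dim_hull].
Qed.

Lemma homog_neq0 (x : 'rV[R]_n) : homog x != 0 :> E.
Proof. by rewrite xpair_eqE oner_eq0. Qed.

Lemma f_number0 Y : convex_position v Y -> f_number 0 (hull p Y) = #|Y|.
Proof.
move=> hY; rewrite f_number_hull -(card_imset _ (@set1_inj I)); apply: eq_card => G.
rewrite inE; apply/andP/imsetP => [[/asboolP hG /eqP rG]|[i iY ->]]; last first.
  split; first by apply/asboolP; exact: hY.
  by rewrite /rk /span_of big_set1 dim_vline homog_neq0.
have sGY := cface_sub hG.
have : (#|G| <= 1)%N.
  rewrite leqNgt; apply/negP => G2.
  by have := rk_ge2 (convex_position_sub hY sGY) G2; rewrite rG.
have := rk_le_card v G; rewrite rG => G1 G2.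
have /cards1P[i ei] : #|G| == 1%N by rewrite eqn_leq G2.
by exists i => //; apply: (fintype.subsetP sGY); rewrite ei finset.set11.
Qed.

Lemma f_number1 Y : convex_position v Y -> f_number 1 (hull p Y) = #|edges v Y|.
Proof.
move=> hY; rewrite f_number_hull; apply: eq_card => G; rewrite !inE andbC.
case: (boolP `[< _ >]) => [/asboolP hG|]; rewrite ?andbF // !andbT.
have hG' := convex_position_sub hY (cface_sub hG).
apply/eqP/eqP => rG.
  by apply/eqP; rewrite eqn_leq (card_le2 hG') ?rG // -rG rk_le_card.
by apply/eqP; rewrite eqn_leq -{1}rG rk_le_card (rk_ge2 hG') // rG.
Qed.

(** For each other [j], [farkas] on the differences [w] yields a form minimal at [p i] and larger at
    [p j]; these forms are summed. The alternative, solved for [p i], puts it in the hull of the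
    others. *)
Lemma exposed_of_notin_hull Y i : i \in Y -> ~ hull p (Y :\ i)%SET (p i) ->
  cface v Y [set i]%SET.
Proof.
move=> iY hi; pose w m := homog (p m) - homog (p i).
have /choice[L hL] : forall j, exists l, j \in (Y :\ i)%SET ->
    [/\ forall m, m \in Y -> 0 <= ev l (homog (p m)), ev l (homog (p i)) = 0 &
        0 < ev l (homog (p j))].
  move=> j; case: (boolP (j \in (Y :\ i)%SET)) => [jY|]; last by exists 0.
  have [[c c0 e]|[l l0 lj]] := farkas w Y (- w j); last first.
    (* [affine_form 0 1] is 1 on homogenized points, so this shifts the value at [p i] to 0. *)
    exists (l - ev l (homog (p i)) *: linfun (affine_form 0 1)) => _.
    have eE m : ev (l - ev l (homog (p i)) *: linfun (affine_form 0 1)) (homog (p m)) = ev l (w m).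
      by rewrite !evE ev_affine_form mulmx0 mxE subr0 mulr1.
    split=> [m mY||]; rewrite eE; [exact: l0|by rewrite /w subrr ev0|].
    by move: lj; rewrite evN oppr_lt0.
  case: hi; apply/hullP.
  pose s : R := \sum_(m in (Y :\ i)%SET) c m.
  have s0 : 0 <= s by exact: sumr_ge0.
  exists (fun m => (1 + s)^-1 * ((m == j)%:R + c m)) => [m|].
    by rewrite mulr_ge0 ?invr_ge0 ?addr_ge0 ?ler0n.
  have h : (1 + s) *: homog (p i) = \sum_(m in (Y :\ i)%SET) ((m == j)%:R + c m) *: homog (p m).
    under eq_bigr do rewrite scalerDl.
    rewrite big_split /= [X in _ = X + _](big_setD1 j) //= eqxx scale1r big1 ?addr0; last first.
      by move=> m /setD1P[/negPf -> _]; rewrite scale0r.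
    move: e; rewrite (big_setD1 i) //= {2}/w subrr scaler0 add0r.
    under eq_bigr do rewrite scalerBr.
    rewrite sumrB -scaler_suml -/s opprB => /eqP.
    by rewrite subr_eq addrAC eq_sym subr_eq scalerDl scale1r eq_sym addrC => /eqP <-; rewrite addrC.
  under eq_bigr do rewrite -scalerA.
  by rewrite -scaler_sumr -h scalerA mulVf ?scale1r // gt_eqF // ltr_pwDl.
have evL m : ev (\sum_(j in (Y :\ i)%SET) L j) (homog (p m)) =
    \sum_(j in (Y :\ i)%SET) ev (L j) (homog (p m)) by rewrite /ev sum_lfunE.
apply: (@cface_of_form _ _ _ _ _ _ (\sum_(j in (Y :\ i)%SET) L j)).
- by rewrite finset.sub1set.
- by move=> m /finset.set1P ->; rewrite evL big1 // => j /hL[].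
- move=> m mY mi; have jm : m \in (Y :\ i)%SET by rewrite !inE mY andbT; rewrite inE in mi.
  rewrite evL (big_setD1 m) //= ltr_pwDl //; first by have [] := hL _ jm.
  by apply: sumr_ge0 => j /setD1P[_ /hL[h _ _]]; exact: h.
Qed.

End Dimension.

(** A generating subset of least cardinality has no redundant point; indexing by positions also
    removes repetitions. *)
Lemma polytope_convex_position (R : realType) n (P : set 'rV[R]_n) : is_polytope P ->
  exists (I : finType) (p : I -> 'rV[R]_n) (Y : {set I}),
    P = hull p Y /\ convex_position (fun i => homog (p i)) Y.
Proof.
move=> [s eP]; pose p (i : 'I_(size s)) := tnth (in_tuple s) i.
have hT : hull p finset.setT = P.
  rewrite eP; congr conv_hull; apply/seteqP; split=> x /=.
    by move=> [i _ <-]; exact: mem_tnth.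
  by move=> /(tnthP (in_tuple s))[i ->]; exists i.
pose Q (Y : {set 'I_(size s)}) := `[< hull p Y = P >].
have QT : Q finset.setT by apply/asboolP.
case: (@arg_minnP _ _ Q (fun Y => #|Y|) QT) => Y /asboolP hY minY.
exists 'I_(size s), p, Y; split=> // i iY; apply: exposed_of_notin_hull => // hi.
suff /minY : Q (Y :\ i)%SET by rewrite (cardsD1 i Y) iY ltnn.
apply/asboolP/seteqP; rewrite -hY; split; first by apply: hullS; exact: subD1set.
apply: hull_sub; first exact: hull_convex.
move=> j jY; have [->//|ji] := eqVneq j i.
by apply: hull_pt; rewrite !inE ji.
Qed.

(** * Iterated pyramids and combinatorial equivalence *)

Section Faces.
Variables (R : realType) (n : nat) (I : finType) (p : I -> 'rV[R]_n).
Local Notation v := (fun i => homog (p i)).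
Implicit Types (A B Y G H : {set I}).

Lemma multi_pyramid_hull A B : [disjoint A & B]%B ->
  (forall a, a \in A -> exists l,
     (forall i, i \in ((A :|: B) :\ a)%SET -> ev l (homog (p i)) = 0) /\ ev l (homog (p a)) != 0) ->
  multi_pyramid #|A| (hull p B) (hull p (A :|: B)%SET).
Proof.
move em : #|A| => m; elim: m A em => [|m IH] A em dAB hA.
  by move/eqP: em; rewrite cards_eq0 => /eqP ->; rewrite /= finset.set0U.
have [a aA] : exists a, a \in A by apply/set0Pn; rewrite -card_gt0 em.
have aB : a \notin B by rewrite (disjointFr dAB aA).
have eAB : (a |: ((A :\ a) :|: B) = A :|: B)%SET by rewrite finset.setUA finset.setD1K.
have sAB : ((A :\ a) :|: B \subset (A :|: B) :\ a)%SET.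
  by rewrite subsetD1 finset.setSU ?subD1set //= !inE eqxx (negPf aB).
exists (hull p ((A :\ a) :|: B)%SET); split.
  apply: IH => [||b /setD1P[ba bA]].
  - by move: em; rewrite (cardsD1 a) aA => -[].
  - exact: disjointWl (subD1set _ _) dAB.
  - have [l [l0 lb]] := hA b bA; exists l; split=> // i /setD1P[ib iAB]; apply: l0.
    by rewrite !inE ib; have := fintype.subsetP sAB _ iAB; rewrite !inE => /andP[_ ->].
exists (p a); split; last by rewrite hull_setU1 eAB.
have [l [l0 la]] := hA a aA; rewrite aff_hull_hull /= => ha; case/eqP: la.
by apply: (vanish_span _ ha) => i /(fintype.subsetP sAB)/l0.
Qed.

Lemma hull_subsetP Y G H : cface v Y G -> cface v Y H ->
  (hull p G `<=` hull p H <-> G \subset H).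
Proof.
move=> hG hH; split=> [h|]; last exact: hullS.
apply/fintype.subsetP => i iG; apply: (cface_hull hH); last by apply: h; exact: hull_pt.
exact: (fintype.subsetP (cface_sub hG)).
Qed.

End Faces.

Lemma hull_reindex (R : realType) n (I J : finType) (p : I -> 'rV[R]_n) (g : J -> I) Y :
  g @: finset.setT = Y -> hull (p \o g) finset.setT = hull p Y.
Proof.
move=> <-; congr conv_hull; apply/seteqP; split=> x /=.
  by move=> [j _ <-]; exists (g j) => //; exact: imset_f.
by move=> [_ /imsetP[j _ ->] <-]; exists j => //; rewrite inE.
Qed.

Lemma comb_equiv_refl (R : realType) n (P : set 'rV[R]_n) : comb_equiv P P.
Proof.
exists id; split=> //; split=> [F //|F G _ _ //|F hF]; by exists F.
Qed.

Lemma comb_equiv_hull (R : realType) m n (J : finType)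
    (p : J -> 'rV[R]_m) (q : J -> 'rV[R]_n) :
  (forall G, cface (fun j => homog (p j)) finset.setT G <->
             cface (fun j => homog (q j)) finset.setT G) ->
  comb_equiv (hull p finset.setT) (hull q finset.setT).
Proof.
(* The identity on index sets; [f] takes arbitrary sets, so the indices are read off by membership
   in [F]. *)
move=> pq; pose f (F : set 'rV[R]_m) := hull q [set j | `[< F (p j) >]]%SET.
have fE G : cface (fun j => homog (p j)) finset.setT G -> f (hull p G) = hull q G.
  move=> hG; congr hull; apply/setP => j; rewrite inE; apply/asboolP/idP.
    exact: (cface_hull hG).
  exact: hull_pt.
exists f; split; last first.
  move=> _ _ /faceP[G hG ->] /faceP[H hH ->]; rewrite !fE //.
  rewrite (hull_subsetP hG hH) (@hull_subsetP _ _ _ q finset.setT) //; exact/pq.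
split.
- by move=> _ /faceP[G hG ->]; rewrite fE //; apply/faceP; exists G => //; exact/pq.
- move=> _ _ /set_mem/faceP[G hG ->] /set_mem/faceP[H hH ->]; rewrite !fE // => e.
  by congr hull; apply: (@hull_inj _ _ _ q finset.setT) => //; exact/pq.
- move=> _ /faceP[G hG ->]; have hG' : cface (fun j => homog (p j)) finset.setT G by exact/pq.
  by exists (hull p G); [apply/faceP; exists G|rewrite fE].
Qed.

(** * The model prism and recognition of a triplex *)

Section ModelPrism.
Variables (R : realType) (k : nat).
Local Notation K := 'I_k.+1.

Definition simplex_pt (i : K) : 'rV[R]_k.+1 := delta_mx 0 i.
Definition segment_pt (i : 'I_2) : 'rV[R]_1 := (i%:R)%:M.
Definition prism_pt (q : K * bool) : 'rV[R]_(k.+1 + 1) :=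
  row_mx (simplex_pt q.1) (segment_pt (if q.2 then ord_max else ord0)).

Lemma simplex_pt_indep : aff_indep simplex_pt.
Proof.
move=> w _ e i; have := congr1 (fun M : 'rV[R]_k.+1 => M 0 i) e.
rewrite summxE mxE (bigD1 i) //= !mxE !eqxx mulr1 big1 ?addr0 // => j ji.
by rewrite !mxE eqxx eq_sym (negPf ji) mulr0.
Qed.

Lemma segment_pt_indep : aff_indep segment_pt.
Proof.
move=> w s0 e; have := congr1 (fun M : 'rV[R]_1 => M 0 0) e.
move: s0; rewrite summxE !big_ord_recl !big_ord0 !mxE /= mulr0 add0r mulr1n mulr1 !addr0.
move=> s0 w1 i; case: (unliftP ord0 i) => [j ->|->]; last by move: s0; rewrite w1 addr0.
by rewrite (ord1 j).
Qed.

(** Convexity is used in one factor at a time, the other being held fixed. *)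
Lemma prod_simplex_segment :
  prod_polytope (conv_hull (range simplex_pt)) (conv_hull (range segment_pt)) =
  hull prism_pt finset.setT.
Proof.
have eT (J : finType) m (p : J -> 'rV[R]_m) : conv_hull (range p) = hull p finset.setT.
  by congr conv_hull; apply/seteqP; split=> x /= [i _ <-]; exists i; rewrite ?inE.
rewrite !eT; apply/seteqP; split=> [_ /= [x hx [y hy <-]]|].
  have /convex_setP cv := @hull_convex _ _ _ prism_pt finset.setT.
  have hi i : hull prism_pt finset.setT (row_mx (simplex_pt i) y).
    apply: (hull_sub (A := [set y | hull prism_pt finset.setT (row_mx (simplex_pt i) y)]) _ _ hy).
      apply/convex_setP => t a b t0 t1 /= ha hb.
      suff -> : row_mx (simplex_pt i) (conv_point t a b) =
        conv_point t (row_mx (simplex_pt i) a) (row_mx (simplex_pt i) b) by exact: cv.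
      by rewrite /conv_point !scale_row_mx add_row_mx -scalerDl subrK scale1r.
    move=> j _ /=; have : hull prism_pt finset.setT (prism_pt (i, j == ord_max)).
      by apply: hull_pt; rewrite inE.
    rewrite /prism_pt /=; case: eqP => [-> //|nj]; suff -> : j = ord0 by [].
    by apply/val_inj; case: j nj => [[|[|]]] //= lt h; case: h; apply: val_inj.
  apply: (hull_sub (A := [set x | hull prism_pt finset.setT (row_mx x y)]) _ _ hx) => [|i _]; last exact: hi.
  apply/convex_setP => t a b t0 t1 /= ha hb.
  suff -> : row_mx (conv_point t a b) y = conv_point t (row_mx a y) (row_mx b y) by exact: cv.
  by rewrite /conv_point !scale_row_mx add_row_mx -scalerDl subrK scale1r.
apply: hull_sub => [|[i b] _] /=.
  apply/convex_setP => t _ _ t0 t1 [x hx [y hy <-]] [z hz [u hu <-]].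
  exists (conv_point t x z).
    have /convex_setP cv := @hull_convex _ _ _ simplex_pt finset.setT; exact: cv.
  exists (conv_point t y u).
    have /convex_setP cv := @hull_convex _ _ _ segment_pt finset.setT; exact: cv.
  by rewrite /conv_point !scale_row_mx add_row_mx.
exists (simplex_pt i); first by apply: hull_pt; rewrite inE.
by exists (segment_pt (if b then ord_max else ord0)) => //; apply: hull_pt; rewrite inE.
Qed.

Lemma prism_pt_faces G :
  cface (fun q => homog (prism_pt q)) finset.setT G <-> prism_face G.
Proof.
have evq a (b c : R) q : ev (linfun (affine_form (col_mx a b%:M) c)) (homog (prism_pt q)) =
    c - (a q.1 0 + b * q.2%:R).
  rewrite ev_affine_form /prism_pt mul_row_col mxE; congr (_ - (_ + _)).
    by rewrite /simplex_pt -rowE mxE.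
  by rewrite mul_mx_scalar !mxE eqxx mulr1n; case: q.2.
(* The forms are the height, 1 minus the height and the coordinate [i]; the quadrilaterals are
   parallelograms, whence the coefficients 1. *)
apply: prism_faces => [||i|i j ij].
- apply: (cface_of_form (l := linfun (affine_form (col_mx 0 (-1)%:M) 0))); rewrite ?finset.subsetT //.
    by move=> [i b]; rewrite inE evq mxE /= => /negPf ->; rewrite mulr0 addr0 subr0.
  by move=> [i b] _; rewrite inE evq mxE negbK /= => ->; rewrite mulr1 sub0r add0r opprK.
- apply: (cface_of_form (l := linfun (affine_form (col_mx 0 1%:M) 1))); rewrite ?finset.subsetT //.
    by move=> [i b]; rewrite inE evq mxE /= => ->; rewrite mulr1 add0r subrr.
  by move=> [i b] _; rewrite inE evq mxE /= => /negPf ->; rewrite mulr0 addr0 subr0.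
- apply: (cface_of_form (l := linfun (affine_form (col_mx (- delta_mx i 0) 0%:M) 0))); rewrite ?finset.subsetT //.
    by move=> [j b]; rewrite inE evq !mxE mul0r /= => /negPf ->; rewrite oppr0 addr0 subr0.
  by move=> [j b] _; rewrite inE negbK evq !mxE mul0r /= => ->; rewrite addr0 opprK add0r.
- exists 1, 1, 1; split=> //; rewrite !scale1r /homog; congr pair => /=.
  by rewrite /prism_pt /= !add_row_mx addrC; congr row_mx; rewrite addrC.
Qed.

Lemma simplicial_prism_hull n (J : finType) (p : J -> 'rV[R]_n) (g : K * bool -> J) Y :
  g @: finset.setT = Y ->
  (forall G, cface (fun q => homog (p (g q))) finset.setT G <-> prism_face G) ->
  simplicial_prism k.+1 (hull p Y).
Proof.
move=> gY hG; split; first exact: hull_polytope.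
exists k.+1, 1%N, (conv_hull (range simplex_pt)), (conv_hull (range segment_pt)).
split; first by exists simplex_pt; split=> //; exact: simplex_pt_indep.
split; first by exists segment_pt; split=> //; exact: segment_pt_indep.
rewrite prod_simplex_segment -(hull_reindex p gY); apply: comb_equiv_hull => G.
by rewrite prism_pt_faces -hG.
Qed.

End ModelPrism.

(** The polytope is literally an iterated pyramid, so it is its own model; only its base is compared
    combinatorially with a product. *)
Lemma triplex_of_prism (R : realType) n d k (I : finType) (p : I -> 'rV[R]_n)
    (A B : {set I}) (tau : I -> I) (Y := (A :|: B :|: tau @: B)%SET)
    (v := fun i => homog (p i)) :
  (1 <= k <= d)%N -> #|A| = (d - k)%N -> #|B| = k -> {in B &, injective tau} ->
  [disjoint A & B]%B -> [disjoint (A :|: B)%SET & tau @: B]%B ->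
  cface v Y (A :|: B)%SET -> cface v Y (A :|: tau @: B)%SET ->
  (forall a, a \in A -> cface v Y (Y :\ a)%SET) ->
  (forall s, s \in B -> cface v Y (Y :\: [set s; tau s])%SET) ->
  (forall s s', s \in B -> s' \in B -> s != s' -> exists a b c : R, [/\ 0 < a, 0 < b, 0 < c &
     v (tau s') + a *: v s = b *: v (tau s) + c *: v s']) ->
  triplex d k (hull p Y).
Proof.
move=> hk cA cB tinj dAB dABT fB fT fA fS cross; split=> //; split; first exact: hull_polytope.
have sYT t : t \in tau @: B -> (t \notin A) && (t \notin B).
  by move=> tT; rewrite -negb_or -finset.in_setU (disjointFl dABT tT).
have BA s : s \in B -> s \notin A by move=> sB; rewrite (disjointFl dAB sB).
exists n, (hull p (B :|: tau @: B)%SET), (hull p Y); split; last first.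
  split; last exact: comb_equiv_refl.
  rewrite -cA /Y -finset.setUA; apply: multi_pyramid_hull.
    rewrite disjoint_sym finset.disjoints_subset finset.subUset; apply/andP; split.
      by apply/fintype.subsetP => s sB; rewrite inE BA.
    by apply/fintype.subsetP => t /sYT; rewrite inE => /andP[].
  rewrite finset.setUA => a aA; have [l [l0 lF lX]] := cface_form (fA a aA); exists l; split=> //.
  by rewrite gt_eqF // lX ?inE ?aA ?eqxx.
case: k hk cA cB => [//|k] hk cA cB.
pose s (i : 'I_k.+1) := enum_val (cast_ord (esym cB) i).
have sB i : s i \in B := enum_valP _.
have s_inj : injective s by move=> i j /enum_val_inj/cast_ord_inj.
have s_onto x : x \in B -> exists i, x = s i.
  move=> xB; exists (cast_ord cB (enum_rank_in xB x)).
  by rewrite /s cast_ord_comp cast_ord_id enum_rankK_in.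
have tB i : tau (s i) \in tau @: B by exact: imset_f.
pose g (q : 'I_k.+1 * bool) := if q.2 then tau (s q.1) else s q.1.
have sT i j : (s i == tau (s j)) = false.
  by apply/eqP => e; have /andP[_] := sYT _ (tB j); rewrite -e sB.
have gY q : g q \in Y.
  by rewrite /g /Y !finset.in_setU; case: q.2; rewrite ?sB ?tB ?orbT.
apply: (@simplicial_prism_hull _ _ _ _ _ g).
  apply/setP => x; apply/imsetP/finset.setUP => [[[i [|]] _ ->]|[/s_onto[i ->]|]].
  - by right; exact: tB.
  - by left; exact: sB.
  - by exists (i, false).
  - by case/imsetP => y /s_onto[i ->] ->; exists (i, true).
apply: prism_faces => [||i|i j ij].
- have -> : [set q | ~~ q.2]%SET = g @^-1: (A :|: B).
    apply/setP => -[i [|]]; rewrite !inE /g /= ?sB ?orbT //.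
    by have /andP[/negPf -> /negPf ->] := sYT _ (tB i).
  exact: (cface_reindex gY fB).
- have -> : [set q | q.2]%SET = g @^-1: (A :|: tau @: B).
    apply/setP => -[i [|]]; rewrite finset.in_set finset.inE /g /= finset.in_setU ?tB ?orbT //.
    rewrite (negPf (BA _ (sB i))) /=; apply/esym/negbTE/negP => /sYT.
    by rewrite sB andbF.
  exact: (cface_reindex gY fT).
- have -> : [set q | q.1 != i]%SET = g @^-1: (Y :\: [set s i; tau (s i)]).
    apply/setP => -[j b]; rewrite finset.in_set [RHS]finset.inE finset.in_setD gY andbT !inE /g /=.
    case: b; rewrite ?sT 1?(eq_sym (tau _) (s _)) ?sT ?orbF /= ?(inj_eq s_inj) //.
    by rewrite (inj_in_eq tinj) ?sB // (inj_eq s_inj).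
  exact: (cface_reindex gY (fS _ (sB i))).
- by apply: cross; rewrite ?sB // (inj_eq s_inj).
Qed.

Theorem theorem18 (R : realType) (n d k : nat) (P : set 'rV[R]_n)
  (hk : (4 <= k)%N) (hkd : (k <= d)%N)
  (hP : is_polytope P) (hdim : has_dim P d)
  (hv : f_number 0 P = (d + k)%N)
  (hT : ~ triplex d k P) :
  (phi (d + k) d + k - 3 <= f_number 1 P)%N /\
  ((k - 1) * (d - k) + 2 * (k - 3))%N%:Z <= excess_degree d P.
Proof.
have [I [p [Y [eP hY]]]] := polytope_convex_position hP; subst P.
have rY : rk (fun i => homog (p i)) Y = d.+1 by apply/has_dim_hull.
have cY : #|Y| = (d + k)%N by rewrite -(f_number0 hY).
rewrite /excess_degree hv f_number1 //.
have : (d * d + (k - 3) <= #|edges (fun i => homog (p i)) Y| + 'C(d.+1 - k, 2))%N.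
  rewrite leqNgt; apply/negP => few; apply: hT.
  have [A [B [tau [[cA cB tinj] [dAB dABT eY] [fB fT fA fS] cross]]]] :=
    few_edges_prism hY rY cY hk hkd few.
  by subst Y; apply: (triplex_of_prism _ cA cB tinj) => //; rewrite (leq_trans _ hk).
move: #|_| => e; rewrite /phi.
have -> : (2 * d + 1 - (d + k) = d.+1 - k)%N by lia.
(* Once the binomials are expanded, both conclusions are this one bound. *)
have [a ea] : exists a, d = (k + a)%N by exists (d - k)%N; lia.
have [b eb] : exists b, k = (b + 4)%N by exists (k - 4)%N; lia.
have := bin2_mul2 d.+1; have := bin2_mul2 d; have := bin2_mul2 (d.+1 - k).
have -> : (d.+1 - k = a.+1)%N by lia.
move: 'C(_, _) 'C(_, _) 'C(_, _) => x y z; rewrite /= ea eb.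
have -> : ((b + 4 + a).-1 = b + a + 3)%N by lia.
have -> : (b + 4 - 3 = b + 1)%N by lia.
have -> : (b + 4 - 1 = b + 3)%N by lia.
have -> : (b + 4 + a - (b + 4) = a)%N by lia.
by clear; split; lia.
Qed.
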